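(* Let $S$ be a Hausdorff topological semigroup containing the bicyclic semigroup $\mathcal C(p,q)$ as a dense subsemigroup, and assume $S$ is countably compact at the set $E_C=\{p^nq^n:n\in\omega\}$. Then: (1) the closure $\bar E_C$ of $E_C$ in $S$ is compact and has a unique non-isolated point $e$; $e$ is an idempotent commuting with all elements of $S$, and the sequence $(p^nq^n)_{n}$ converges to $e$; (2) the map $\pi:S\to S$, $\pi(x)=xe=ex$, is a continuous homomorphism which retracts $S$ onto the ideal $M=S\setminus\mathcal C(p,q)$, and $e$ is a two-sided unit of $M$; (3) the element $a=\pi(p)$ generates a dense cyclic subgroup $Z$ of $M$; (4) $\pi(p^nq^m)=a^{n-m}$ for all $n,m\in\omega$; (5) $\lim_{n\to\infty}p^{n+k}q^n=a^k$ for every $k\in\mathbb Z$ (powers of $a$ taken in the group $Z$); (6) $S$ is regular if and only if $M$ is regular; (7) if $S$ is regular and countably compact at $\mathcal C(p,q)$, then $S$ is topologically isomorphic (via the identity map) to $\mathcal C(p,q)\cup_{\pi|\mathcal C(p,q)}M$, and the set $\{(q^ne,p^ne):n\in\omega\}$ is closed and discrete in $M\times M$; (8) if $S$ is Tychonoff and countably compact at $\mathcal C(p,q)$, then $M$ is not openly factorizable, $M\times M$ is not pseudocompact, and $M$ contains no dense totally bounded topological subgroup.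
   Context: The bicyclic semigroup $\mathcal C(p,q)$ is the semigroup with identity $1$ generated by $p,q$ subject to the single relation $qp=1$; every element is uniquely $p^nq^m$ ($n,m\in\omega$), and $p^mq^n\cdot p^iq^j$ equals $p^mq^{n-i+j}$ if $n\ge i$ and $p^{m+i-n}q^j$ if $n\le i$. A space $X$ is countably compact at $A\subset X$ if every infinite $B\subset A$ has an accumulation point in $X$ (a point each of whose neighborhoods contains infinitely many points of $B$). For a discrete space $D$: if $D$ is infinite, $\alpha D=D\cup\{\infty\}$ is its one-point compactification; if finite, $\alpha D$ is the sum of $D$ and an isolated point $\infty$. For a map $\pi:D\to M$, $D\cup_\pi M$ is the subspace $\{(x,\pi(x)):x\in D\}\cup(\{\infty\}\times M)$ of $\alpha D\times M$, with $D$ identified with $\{(x,\pi(x))\}$ and $M$ with $\{\infty\}\times M$; for a semigroup homomorphism $\pi$ it carries the operation extending those of $D$ and $M$ by $xy=\pi(x)y$ ($x\in D,y\in M$), $xy=x\pi(y)$ ($x\in M,y\in D$). Pseudocompact: every locally finite open cover is finite. Openly factorizable: every continuous map $f:X\to Y$ into a separable metrizable $Y$ factors as $g\circ p$ with $p:X\to K$ an open continuous surjection onto a separable metrizable $K$ and $g$ continuous. *)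

(* Defs.v *)
From Stdlib Require Import Reals Lra List ZArith Arith.
Set Implicit Arguments.

Record topology (X : Type) := Topology {
  is_open : (X -> Prop) -> Prop;
  open_setT : is_open (fun _ => True);
  open_inter : forall U V, is_open U -> is_open V -> is_open (fun x => U x /\ V x);
  open_bigU : forall F : (X -> Prop) -> Prop,
      (forall U, F U -> is_open U) -> is_open (fun x => exists U, F U /\ U x)
}.
Arguments is_open {X} t U.

Section Basic.
Variables (X Y : Type).

Definition is_closed (T : topology X) (F : X -> Prop) : Prop :=
  is_open T (fun x => ~ F x).

Definition finite_set {Z : Type} (A : Z -> Prop) : Prop :=
  exists l : list Z, forall z, A z -> In z l.

Definition closure (T : topology X) (A : X -> Prop) (x : X) : Prop :=
  forall U, is_open T U -> U x -> exists y, U y /\ A y.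

Definition dense (T : topology X) (A : X -> Prop) : Prop :=
  forall x, closure T A x.

Definition hausdorff (T : topology X) : Prop :=
  forall x y, x <> y -> exists U V, is_open T U /\ is_open T V /\ U x /\ V y /\
    forall z, U z -> V z -> False.

Definition T1 (T : topology X) : Prop :=
  forall x y, x <> y -> exists U, is_open T U /\ U x /\ ~ U y.

Definition regular (T : topology X) : Prop :=
  forall x F, is_closed T F -> ~ F x ->
    exists U V, is_open T U /\ is_open T V /\ U x /\ (forall z, F z -> V z) /\
      forall z, U z -> V z -> False.

Definition continuous (T : topology X) (T' : topology Y) (f : X -> Y) : Prop :=
  forall V, is_open T' V -> is_open T (fun x => V (f x)).

Definition open_map (T : topology X) (T' : topology Y) (f : X -> Y) : Prop :=
  forall U, is_open T U -> is_open T' (fun y => exists x, U x /\ f x = y).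

Definition accumulation_point (T : topology X) (B : X -> Prop) (x : X) : Prop :=
  forall U, is_open T U -> U x -> ~ finite_set (fun y => U y /\ B y).

Definition countably_compact_at (T : topology X) (A : X -> Prop) : Prop :=
  forall B, (forall x, B x -> A x) -> ~ finite_set B ->
    exists x, accumulation_point T B x.

Definition compact_set (T : topology X) (K : X -> Prop) : Prop :=
  forall F : (X -> Prop) -> Prop, (forall U, F U -> is_open T U) ->
    (forall x, K x -> exists U, F U /\ U x) ->
    exists l : list (X -> Prop), (forall U, In U l -> F U) /\
      (forall x, K x -> exists U, In U l /\ U x).

Definition nonisolated_in (T : topology X) (A : X -> Prop) (x : X) : Prop :=
  A x /\ forall U, is_open T U -> U x -> exists y, U y /\ A y /\ y <> x.

Definition discrete_set (T : topology X) (A : X -> Prop) : Prop :=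
  forall x, A x -> exists U, is_open T U /\ U x /\ forall y, U y -> A y -> y = x.

Definition converges (T : topology X) (s : nat -> X) (x : X) : Prop :=
  forall U, is_open T U -> U x -> exists N, forall n, (N <= n)%nat -> U (s n).

Definition pseudocompact (T : topology X) : Prop :=
  forall F : (X -> Prop) -> Prop,
    (forall U, F U -> is_open T U) ->
    (forall x, exists U, F U /\ U x) ->
    (forall x, exists W, is_open T W /\ W x /\
        finite_set (fun U => F U /\ exists y, U y /\ W y)) ->
    finite_set F.

End Basic.

(* subspace topology on {x | A x} (local description of  U = V ∩ A) *)
Section Subspace.
Variables (X : Type) (T : topology X) (A : X -> Prop).

Definition sub_open (U : {x | A x} -> Prop) : Prop :=
  forall z, U z -> exists V, is_open T V /\ V (proj1_sig z) /\
    forall w, V (proj1_sig w) -> U w.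

Lemma sub_open_setT : sub_open (fun _ => True).
Proof. intros z _; exists (fun _ => True); split; [apply open_setT|auto]. Qed.

Lemma sub_open_inter U V : sub_open U -> sub_open V -> sub_open (fun x => U x /\ V x).
Proof.
  intros HU HV z [Uz Vz].
  destruct (HU z Uz) as [U' [oU' [U'z HU']]].
  destruct (HV z Vz) as [V' [oV' [V'z HV']]].
  exists (fun x => U' x /\ V' x); split; [apply open_inter; auto|].
  split; [auto|]. intros w [h1 h2]; split; auto.
Qed.

Lemma sub_open_bigU (F : ({x | A x} -> Prop) -> Prop) :
  (forall U, F U -> sub_open U) -> sub_open (fun x => exists U, F U /\ U x).
Proof.
  intros HF z [U [FU Uz]].
  destruct (HF U FU z Uz) as [V [oV [Vz HV]]].
  exists V; repeat split; auto. intros w Vw; exists U; auto.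
Qed.

Definition subspace : topology {x | A x} :=
  Topology sub_open sub_open_setT sub_open_inter sub_open_bigU.
End Subspace.

Section Product.
Variables (X Y : Type) (T : topology X) (T' : topology Y).

Definition prod_open (W : X * Y -> Prop) : Prop :=
  forall p, W p -> exists U V, is_open T U /\ is_open T' V /\ U (fst p) /\ V (snd p) /\
    forall a b, U a -> V b -> W (a, b).

Lemma prod_open_setT : prod_open (fun _ => True).
Proof.
  intros p _; exists (fun _ => True), (fun _ => True); repeat split; auto; apply open_setT.
Qed.

Lemma prod_open_inter U V : prod_open U -> prod_open V -> prod_open (fun x => U x /\ V x).
Proof.
  intros HU HV p [Up Vp].
  destruct (HU p Up) as [U1 [V1 [o1 [o1' [h1 [h1' H1]]]]]].
  destruct (HV p Vp) as [U2 [V2 [o2 [o2' [h2 [h2' H2]]]]]].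
  exists (fun x => U1 x /\ U2 x), (fun y => V1 y /\ V2 y).
  repeat split; try apply open_inter; auto.
  - apply H1; tauto.
  - apply H2; tauto.
Qed.

Lemma prod_open_bigU (F : (X * Y -> Prop) -> Prop) :
  (forall U, F U -> prod_open U) -> prod_open (fun x => exists U, F U /\ U x).
Proof.
  intros HF p [U [FU Up]].
  destruct (HF U FU p Up) as [U1 [V1 [o1 [o1' [h1 [h1' H1]]]]]].
  exists U1, V1; repeat split; auto. intros a b Ha Hb; exists U; auto.
Qed.

Definition prod_top : topology (X * Y) :=
  Topology prod_open prod_open_setT prod_open_inter prod_open_bigU.
End Product.

(* one-point compactification  alpha D = D ∪ {∞}  of an infinite discrete
   space D; ∞ is None.  Neighbourhoods of ∞ are the cofinite sets. *)
Section Alpha.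
Variable D : Type.

Definition alpha_open (U : option D -> Prop) : Prop :=
  U None -> exists l : list D, forall d, ~ In d l -> U (Some d).

Lemma alpha_open_setT : alpha_open (fun _ => True).
Proof. intros _; exists nil; auto. Qed.

Lemma alpha_open_inter U V : alpha_open U -> alpha_open V -> alpha_open (fun x => U x /\ V x).
Proof.
  intros HU HV [UN VN].
  destruct (HU UN) as [l1 H1]; destruct (HV VN) as [l2 H2].
  exists (l1 ++ l2); intros d Hd; split;
    [apply H1 | apply H2]; intro; apply Hd; apply in_or_app; auto.
Qed.

Lemma alpha_open_bigU (F : (option D -> Prop) -> Prop) :
  (forall U, F U -> alpha_open U) -> alpha_open (fun x => exists U, F U /\ U x).
Proof.
  intros HF [U [FU UN]]. destruct (HF U FU UN) as [l Hl].
  exists l; intros d Hd; exists U; auto.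
Qed.

Definition alpha_top : topology (option D) :=
  Topology alpha_open alpha_open_setT alpha_open_inter alpha_open_bigU.
End Alpha.

Section MetricTop.
Variables (X : Type) (d : X -> X -> R).

Definition metric_open (U : X -> Prop) : Prop :=
  forall x, U x -> exists eps, (0 < eps)%R /\ forall y, (d x y < eps)%R -> U y.

Lemma metric_open_setT : metric_open (fun _ => True).
Proof. intros x _; exists 1%R; split; [lra|auto]. Qed.

Lemma metric_open_inter U V : metric_open U -> metric_open V ->
  metric_open (fun x => U x /\ V x).
Proof.
  intros HU HV x [Ux Vx].
  destruct (HU x Ux) as [e1 [he1 H1]]; destruct (HV x Vx) as [e2 [he2 H2]].
  exists (Rmin e1 e2); split; [apply Rmin_glb_lt; auto|].
  intros y Hy; split; [apply H1 | apply H2];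
    eapply Rlt_le_trans; eauto; [apply Rmin_l | apply Rmin_r].
Qed.

Lemma metric_open_bigU (F : (X -> Prop) -> Prop) :
  (forall U, F U -> metric_open U) -> metric_open (fun x => exists U, F U /\ U x).
Proof.
  intros HF x [U [FU Ux]]. destruct (HF U FU x Ux) as [e [he H]].
  exists e; split; auto. intros y Hy; exists U; auto.
Qed.

Definition metric_top : topology X :=
  Topology metric_open metric_open_setT metric_open_inter metric_open_bigU.

Definition is_metric : Prop :=
  (forall x y, (0 <= d x y)%R) /\ (forall x y, d x y = 0%R <-> x = y) /\
  (forall x y, d x y = d y x) /\ (forall x y z, (d x z <= d x y + d y z)%R).
End MetricTop.

Definition R_top : topology R := metric_top (fun x y => Rabs (x - y)).

Definition tychonoff {X : Type} (T : topology X) : Prop :=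
  T1 T /\ forall x F, is_closed T F -> ~ F x ->
    exists f : X -> R, continuous T R_top f /\ f x = 0%R /\ forall y, F y -> f y = 1%R.

Definition metrizable {X : Type} (T : topology X) : Prop :=
  exists d : X -> X -> R, is_metric d /\ forall U, is_open T U <-> is_open (metric_top d) U.

Definition countable_set {X : Type} (A : X -> Prop) : Prop :=
  exists g : X -> nat, forall x y, A x -> A y -> g x = g y -> x = y.

Definition separable {X : Type} (T : topology X) : Prop :=
  exists A : X -> Prop, countable_set A /\ dense T A.

Definition sep_metrizable {X : Type} (T : topology X) : Prop :=
  separable T /\ metrizable T.

Definition openly_factorizable {X : Type} (T : topology X) : Prop :=
  forall (Y : Type) (TY : topology Y), sep_metrizable TY ->
  forall f : X -> Y, continuous T TY f ->
    exists (K : Type) (TK : topology K) (p : X -> K) (g : K -> Y),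
      sep_metrizable TK /\ continuous T TK p /\ open_map T TK p /\
      (forall k, exists x, p x = k) /\ continuous TK TY g /\
      forall x, f x = g (p x).

(* The bicyclic semigroup C(p,q): p^m q^n is the pair (m,n)             *)

Definition bic (x y : nat * nat) : nat * nat :=
  let (m, n) := x in let (i, k) := y in
  if Nat.leb i n then (m, n - i + k) else (m + i - n, k).

Definition outside_C {S : Type} (j : nat * nat -> S) (x : S) : Prop :=
  forall c, x <> j c.

Fixpoint npow {S : Type} (mul : S -> S -> S) (e x : S) (n : nat) : S :=
  match n with O => e | Datatypes.S n' => mul x (npow mul e x n') end.

Definition zpow {S : Type} (mul : S -> S -> S) (e a b : S) (k : Z) : S :=
  match k with
  | Z0 => e
  | Zpos p => npow mul e a (Pos.to_nat p)
  | Zneg p => npow mul e b (Pos.to_nat p)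
  end.

(* the space C(p,q) ∪_π M : a subspace of alpha(C(p,q)) × S
   (equivalently of alpha(C(p,q)) × M, since M carries the subspace topology) *)
Definition cup_points {S : Type} (j : nat * nat -> S) (pi : S -> S)
  (z : option (nat * nat) * S) : Prop :=
  (exists c, z = (Some c, pi (j c))) \/ (exists m, outside_C j m /\ z = (None, m)).

Definition cup_mul {S : Type} (mul : S -> S -> S) (j : nat * nat -> S) (pi : S -> S)
  (z w : option (nat * nat) * S) : option (nat * nat) * S :=
  match z, w with
  | (Some c, _), (Some d, _) => (Some (bic c d), pi (j (bic c d)))
  | (Some c, _), (None, y) => (None, mul (pi (j c)) y)
  | (None, x), (Some d, _) => (None, mul x (pi (j d)))
  | (None, x), (None, y) => (None, mul x y)
  end.

Definition embedding {X Y : Type} (T : topology X) (T' : topology Y) (f : X -> Y) : Prop :=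
  (forall x y, f x = f y -> x = y) /\ continuous T T' f /\
  forall U, is_open T U -> exists V, is_open T' V /\ forall x, U x <-> V (f x).

(* Main.v *)
(* Put E_n = p^n q^n and C = C(p,q).  The neighbourhood {x : E_(m+1) x <> x, x E_(n+1) <> x} of p^m q^n
   has finite trace on C, so C is discrete and open in S, and every x outside C is fixed by all E_n on one
   side.  An accumulation point e of E_C satisfies E_n e = e = e E_n, which forces uniqueness, hence
   E_n -> e, and e is a central idempotent acting as a unit on M = S \ C.

   Under regularity and countable compactness at C, an element c of C close to x in M after projection
   is close to x itself, up to finitely many exceptions.  As q^n p^n = 1 while M is an ideal,
   the sequence (a^-n, a^n) is therefore locally finite in M x M.  Consequently there are a neighbourhood
   U of e and a function f, vanishing at e and equal to 1 off U, such that no infinite set I of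
   exponents has a^(n-m) in U for all n, m in I; and x |-> f(x .) is not continuous for the sup norm.

   This sup-norm continuity would hold if M x M were pseudocompact (Frolik), or if M were openly
   factorizable, for f(x y) would then be a continuous function on M x K with K the metrizable image of an
   open map.  If H is a dense totally bounded topological subgroup, infinitely many a^n lie in one translate
   of the closure of a small neighbourhood of e in H, and by regularity inversion is continuous at e on
   the units of M, so that the quotients a^(n-m) of these elements lie in U. *)
Require Import Defs.
From Stdlib Require Import Reals List ZArith Arith.
From Stdlib Require Import Lra Lia Classical ClassicalEpsilon FunctionalExtensionality PropExtensionality.
From Stdlib Require Cantor.

(** * Open sets, closures and Hausdorff separation *)

Section Topology.
Context {X : Type} (T : topology X).

(** The hypothesis presents [U] as the union of its open subsets; extensionality turns this into an
    equality of predicates, to which [open_bigU] applies. *)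
Lemma open_local (U : X -> Prop) :
  (forall x, U x -> exists V, is_open T V /\ V x /\ forall y, V y -> U y) ->
  is_open T U.
Proof.
  intros H.
  replace U with (fun x => exists V, (is_open T V /\ forall y, V y -> U y) /\ V x).
  - apply open_bigU; intros V [oV _]; exact oV.
  - apply functional_extensionality; intro x; apply propositional_extensionality; split.
    + intros [V [[_ HV] Vx]]; auto.
    + intros Ux; destruct (H x Ux) as [V [oV [Vx HV]]]; exists V; auto.
Qed.

Lemma open_ext (U V : X -> Prop) : is_open T U -> (forall x, U x <-> V x) -> is_open T V.
Proof.
  intros oU HUV; apply open_local; intros x Vx; exists U.
  split; [exact oU|]; split; [apply HUV, Vx | intros y; apply HUV].
Qed.

Lemma open_or (U V : X -> Prop) :
  is_open T U -> is_open T V -> is_open T (fun x => U x \/ V x).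
Proof.
  intros oU oV; apply open_local; intros x [h|h]; [exists U | exists V]; auto.
Qed.

Lemma open_forall_in {I : Type} (l : list I) (P : I -> X -> Prop) :
  (forall i, In i l -> is_open T (P i)) -> is_open T (fun x => forall i, In i l -> P i x).
Proof.
  induction l as [|i l IH]; intros H.
  - apply (open_ext (fun _ => True)); [apply open_setT|]; simpl; tauto.
  - apply (open_ext (fun x => P i x /\ forall k, In k l -> P k x)).
    + apply open_inter; [apply H; left; auto | apply IH; intros k Hk; apply H; right; auto].
    + intros x; split.
      * intros [h1 h2] k [<-|hk]; auto.
      * intros h; split; [apply h; left; auto | intros k hk; apply h; right; auto].
Qed.

Lemma closure_mono (A B : X -> Prop) x :
  (forall y, A y -> B y) -> closure T A x -> closure T B x.
Proof. intros H Hx U oU Ux; destruct (Hx U oU Ux) as [y [h1 h2]]; eauto. Qed.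

Lemma regular_shrink (U : X -> Prop) x : regular T -> is_open T U -> U x ->
  exists V, is_open T V /\ V x /\ forall y, closure T V y -> U y.
Proof.
  intros reg oU Ux.
  destruct (reg x (fun y => ~ U y)) as [V [W [oV [oW [Vx [HW HVW]]]]]].
  - apply (open_ext U); [exact oU|]; intro y; split; [tauto | apply NNPP].
  - tauto.
  - exists V; repeat split; auto.
    intros y Hy; apply NNPP; intro nUy.
    destruct (Hy W oW (HW y nUy)) as [z [Wz Vz]]; eauto.
Qed.

Lemma finite_set_sub (A B : X -> Prop) :
  (forall x, A x -> B x) -> finite_set B -> finite_set A.
Proof. intros H [l Hl]; exists l; auto. Qed.

Hypothesis haus : hausdorff T.

Lemma open_neq x : is_open T (fun y => y <> x).
Proof.
  apply open_local; intros y Hy.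
  destruct (haus y x Hy) as [U [V [oU [oV [Uy [Vx HUV]]]]]].
  exists U; repeat split; auto; intros z Uz ->; eauto.
Qed.

Lemma open_notin (l : list X) : is_open T (fun y => ~ In y l).
Proof.
  apply (open_ext (fun y => forall z, In z l -> y <> z)).
  - apply open_forall_in; intros z _; apply open_neq.
  - intros y; split; [intros H h; exact (H y h eq_refl) | intros H z hz ->; auto].
Qed.

(** Finite sets are closed in a Hausdorff space, so neighbourhoods of [x] can be shrunk to miss
    [l]. *)
Lemma closure_notin (A : X -> Prop) (l : list X) x :
  closure T A x -> ~ In x l -> closure T (fun y => A y /\ ~ In y l) x.
Proof.
  intros Hx nx U oU Ux.
  destruct (Hx (fun y => U y /\ ~ In y l)) as [y [[h1 h2] h3]].
  - apply open_inter; [exact oU | apply open_notin].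
  - auto.
  - exists y; auto.
Qed.

End Topology.

Section Maps.
Context {X Y : Type} (T : topology X) (T' : topology Y).

Lemma open_eq_compl (f g : X -> Y) : hausdorff T' ->
  continuous T T' f -> continuous T T' g -> is_open T (fun x => f x <> g x).
Proof.
  intros haus cf cg; apply open_local; intros x Hx.
  destruct (haus _ _ Hx) as [U [V [oU [oV [Ux [Vx HUV]]]]]].
  exists (fun y => U (f y) /\ V (g y)); split; [apply open_inter; auto|].
  split; [auto|]; intros y [h1 h2] E; apply (HUV (f y)); auto; rewrite E; auto.
Qed.

Lemma eq_on_closure (f g : X -> Y) (A : X -> Prop) x : hausdorff T' ->
  continuous T T' f -> continuous T T' g -> (forall y, A y -> f y = g y) ->
  closure T A x -> f x = g x.
Proof.
  intros haus cf cg H Hx; apply NNPP; intro ne.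
  destruct (Hx _ (open_eq_compl _ _ haus cf cg) ne) as [y [h1 h2]]; auto.
Qed.

End Maps.

Lemma continuous_pair {X Y Z : Type} (T : topology X) (T1 : topology Y) (T2 : topology Z) f g :
  continuous T T1 f -> continuous T T2 g ->
  continuous T (prod_top T1 T2) (fun x => (f x, g x)).
Proof.
  intros cf cg W oW; apply open_local; intros x Wx.
  destruct (oW _ Wx) as [U [V [oU [oV [Ux [Vx H]]]]]]; simpl in *.
  exists (fun y => U (f y) /\ V (g y)); split; [apply open_inter; auto|].
  split; [auto|]; intros y [h1 h2]; auto.
Qed.

Lemma open_box {X Y : Type} (TX : topology X) (TY : topology Y) A B :
  is_open TX A -> is_open TY B -> is_open (prod_top TX TY) (fun z => A (fst z) /\ B (snd z)).
Proof.
  intros oA oB z [Az Bz]; exists A, B; simpl; auto 6.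
Qed.

Lemma converges_image {X Y : Type} (T : topology X) (T' : topology Y) (f : X -> Y) s x :
  continuous T T' f -> converges T s x -> converges T' (fun n => f (s n)) (f x).
Proof. intros cf Hs U oU Ux; exact (Hs _ (cf U oU) Ux). Qed.

(** * Clustering of boxes and uniform continuity *)

Definition unbounded (I : nat -> Prop) : Prop := forall N, exists n, N <= n /\ I n.

Lemma not_unbounded (I : nat -> Prop) : ~ unbounded I <-> exists N, forall n, N <= n -> ~ I n.
Proof.
  split.
  - intros H; apply not_all_ex_not in H as [N HN]; exists N; intros n Hn In; eauto.
  - intros [N HN] H; destruct (H N) as [n [h1 h2]]; exact (HN n h1 h2).
Qed.

(** Induction on the list: if a colour [a] occurs only below some [N], restricting [I] to [N <= n]
    removes that colour. *)
Lemma unbounded_pigeonhole {A : Type} (l : list A) (P : A -> nat -> Prop) (I : nat -> Prop) :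
  unbounded I -> (forall n, I n -> exists a, In a l /\ P a n) ->
  exists a, In a l /\ unbounded (fun n => I n /\ P a n).
Proof.
  revert I; induction l as [|a l IH]; intros I uI H.
  - destruct (uI 0) as [n [_ In]]; destruct (H n In) as [a [[] _]].
  - destruct (classic (unbounded (fun n => I n /\ P a n))) as [u|u].
    + exists a; split; [left; auto | auto].
    + apply not_unbounded in u as [N HN].
      destruct (IH (fun n => I n /\ N <= n)) as [a' [h1 h2]].
      * intros N'; destruct (uI (max N N')) as [n [h1 h2]]; exists n; repeat split; auto; lia.
      * intros n [In Hn]; destruct (H n In) as [a' [[<-|h] h']]; [|eauto].
        destruct (HN n Hn); auto.
      * exists a'; split; [right; auto|].
        intros N'; destruct (h2 N') as [n [? [[? ?] ?]]]; exists n; auto.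
Qed.

Lemma finite_set_bounded {A : Type} (P : A -> Prop) (s : nat -> A) :
  (forall n m, s n = s m -> n = m) -> finite_set P -> exists N, forall n, N <= n -> ~ P (s n).
Proof.
  intros inj [l Hl]; apply not_unbounded; intro u.
  destruct (unbounded_pigeonhole l (fun a n => a = s n) _ u) as [a [_ ua]]; [eauto|].
  destruct (ua 0) as [n [_ [_ hn]]]; destruct (ua (S n)) as [m [hm [_ hm']]].
  assert (n = m) by (apply inj; congruence); lia.
Qed.

(** A sequential form of pseudocompactness of the product, restricted to boxes. It is the common
    ground of the two arguments that pair [M] with itself and with a metrizable image of [M]. *)
Definition box_clustering {X Y : Type} (TX : topology X) (TY : topology Y) : Prop :=
  forall (O : nat -> X -> Prop) (V : nat -> Y -> Prop),
    (forall n, is_open TX (O n) /\ exists x, O n x) ->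
    (forall n, is_open TY (V n) /\ exists y, V n y) ->
    exists x y, forall A B, is_open TX A -> A x -> is_open TY B -> B y ->
      unbounded (fun n => (exists x', A x' /\ O n x') /\ (exists y', B y' /\ V n y')).

(* Frolik's lemma behind Glicksberg's theorem.  If it fails at [x0], one builds boxes [O n * V n] and
   shrinking neighbourhoods [A n] of [x0] such that [F] oscillates by more than [eps/2] between
   [O n] and [A (n+1)] over every point of [V n]; as [O m] lies in [A (n+1)] for [m > n],
   a cluster point of the boxes is a point of discontinuity. *)
Lemma box_clustering_uniform {X Y : Type} (TX : topology X) (TY : topology Y) (F : X -> Y -> R) :
  box_clustering TX TY ->
  (forall x y eps, (0 < eps)%R -> exists A B, is_open TX A /\ is_open TY B /\ A x /\ B y /\
     forall x' y', A x' -> B y' -> (Rabs (F x' y' - F x y) < eps)%R) ->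
  forall x0 eps, (0 < eps)%R -> exists A, is_open TX A /\ A x0 /\
     forall x y, A x -> (Rabs (F x y - F x0 y) <= eps)%R.
Proof.
  intros clust cF x0 eps Heps; apply NNPP; intro Hno.
  pose (N := {A : X -> Prop | is_open TX A /\ A x0}).
  pose (Q := fun (A : N) (t : (X -> Prop) * (Y -> Prop) * N) =>
    let O := fst (fst t) in let V := snd (fst t) in let A' := snd t in
    (is_open TX O /\ exists x, O x) /\ (is_open TY V /\ exists y, V y) /\
    (forall x, O x -> proj1_sig A x) /\ (forall x, proj1_sig A' x -> proj1_sig A x) /\
    forall x x' y, O x -> proj1_sig A' x' -> V y -> (eps / 2 < Rabs (F x y - F x' y))%R).
  assert (step : forall A : N, {t | Q A t}).
  { intros [A [oA Ax0]]; apply constructive_indefinite_description.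
    assert (exists x y, A x /\ (eps < Rabs (F x y - F x0 y))%R) as [x [y [Ax Hxy]]].
    { apply NNPP; intro h; apply Hno; exists A; repeat split; auto.
      intros x y Ax; apply Rnot_lt_le; intro; apply h; eauto. }
    (* A gap above [eps] loses at most [eps/4] at each end, which leaves [eps/2]. Near a cluster
       point two values within [eps/4] of [F x y] differ by less than that. *)
    destruct (cF x y (eps / 4)%R) as [A1 [B1 [oA1 [oB1 [A1x [B1y H1]]]]]]; [lra|].
    destruct (cF x0 y (eps / 4)%R) as [A2 [B2 [oA2 [oB2 [A2x [B2y H2]]]]]]; [lra|].
    assert (oA' : is_open TX (fun z => A z /\ A2 z) /\ (A x0 /\ A2 x0)).
    { split; [apply open_inter; auto | auto]. }
    exists ((fun z => A z /\ A1 z), (fun z => B1 z /\ B2 z),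
      exist (fun A => is_open TX A /\ A x0) (fun z => A z /\ A2 z) oA').
    unfold Q; simpl; repeat split; try (apply open_inter; auto); try tauto; eauto.
    intros z z' w [_ h1] [_ h2] [h3 h4].
    specialize (H1 z w h1 h3); specialize (H2 z' w h2 h4).
    revert Hxy H1 H2; unfold Rabs; repeat destruct Rcase_abs; lra. }
  assert (A0 : N) by (exists (fun _ => True); split; [apply open_setT | auto]).
  pose (A := fix A n := match n with 0 => A0 | S k => snd (proj1_sig (step (A k))) end).
  pose (O := fun n => fst (fst (proj1_sig (step (A n))))).
  pose (V := fun n => snd (fst (proj1_sig (step (A n))))).
  assert (HQ : forall n, Q (A n) (O n, V n, A (S n))).
  { intro n; unfold O, V; simpl; destruct (step (A n)) as [[[? ?] ?] ?]; simpl; auto. }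
  assert (mono : forall k n x, proj1_sig (A (k + n)) x -> proj1_sig (A n) x).
  { induction k as [|k IH]; intros n x; [auto|]; intro h; apply IH.
    destruct (HQ (k + n)) as [_ [_ [_ [h' _]]]]; apply h', h. }
  destruct (clust O V) as [x [y Hc]].
  { intro n; apply (HQ n). } { intro n; apply (HQ n). }
  destruct (cF x y (eps / 4)%R) as [A1 [B1 [oA1 [oB1 [A1x [B1y H1]]]]]]; [lra|].
  destruct (Hc A1 B1 oA1 A1x oB1 B1y 0) as [n [_ [[z [Az Oz]] [w [Bw Vw]]]]].
  destruct (Hc A1 B1 oA1 A1x oB1 B1y (S n)) as [m [Hm [[z' [Az' Oz']] _]]].
  assert (An : proj1_sig (A (S n)) z').
  { apply (mono (m - S n)); replace (m - S n + S n) with m by lia.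
    destruct (HQ m) as [_ [_ [h _]]]; apply h, Oz'. }
  destruct (HQ n) as [_ [_ [_ [_ h]]]]; specialize (h z z' w Oz An Vw).
  generalize (H1 z w Az Bw) (H1 z' w Az' Bw); revert h.
  unfold Rabs; repeat destruct Rcase_abs; lra.
Qed.

(** Without a cluster point the boxes are locally finite, and the whole space is added to make them
    a cover. Finiteness of the cover bounds only the number of distinct boxes, so one set equals
    [W m] for infinitely many [m], against local finiteness at any of its points. *)
Lemma pseudocompact_box_clustering {X Y : Type} (TX : topology X) (TY : topology Y) :
  pseudocompact (prod_top TX TY) -> box_clustering TX TY.
Proof.
  intros pc O V HO HV; apply NNPP; intro Hno.
  pose (W := fun n (z : X * Y) => O n (fst z) /\ V n (snd z)).
  assert (W_ne : forall n, exists z, W n z).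
  { intro n; destruct (HO n) as [_ [x Ox]]; destruct (HV n) as [_ [y Vy]]; exists (x, y); split; auto. }
  assert (lf : forall z, exists B, is_open (prod_top TX TY) B /\ B z /\
    exists N, forall n, N <= n -> ~ exists z', W n z' /\ B z').
  { intros [x y]; apply NNPP; intro h; apply Hno; exists x, y; intros A B oA Ax oB By.
    apply NNPP; intro u; apply not_unbounded in u as [N HN]; apply h.
    exists (fun z => A (fst z) /\ B (snd z)).
    split; [apply open_box; auto|]; split; [auto|].
    exists N; intros n Hn [[a b] [[h1 h2] [h3 h4]]]; simpl in *; apply (HN n Hn); eauto 6. }
  destruct (pc (fun U => U = (fun _ => True) \/ exists n, U = W n)) as [l Hl].
  - intros U [-> | [n ->]]; [apply open_setT|].
    apply open_box; [apply HO | apply HV].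
  - intro z; exists (fun _ => True); auto.
  - intro z; destruct (lf z) as [B [oB [Bz [N HN]]]]; exists B; repeat split; auto.
    exists ((fun _ => True) :: map W (seq 0 N)); intros U [[-> | [n ->]] [y [h1 h2]]]; [left; auto|].
    right; apply in_map, in_seq; split; [lia|]; apply NNPP; intro.
    apply (HN n); [lia | eauto].
  - destruct (unbounded_pigeonhole l (fun U n => U = W n) (fun _ => True)) as [U [_ HU]].
    + intro N; exists N; auto.
    + intros n _; exists (W n); split; [apply Hl; eauto | auto].
    + destruct (HU 0) as [n [_ [_ ->]]]; destruct (W_ne n) as [z Wz].
      destruct (lf z) as [B [oB [Bz [N HN]]]]; destruct (HU N) as [m [Hm [_ E]]].
      apply (HN m Hm); exists z; rewrite <- E; auto.
Qed.

(** * Subspaces, products and closed discrete sequences *)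

Lemma open_not_closure {X : Type} (T : topology X) (A : X -> Prop) :
  is_open T (fun x => ~ closure T A x).
Proof.
  apply open_local; intros x Hx.
  apply not_all_ex_not in Hx as [U HU]; apply imply_to_and in HU as [oU HU].
  apply imply_to_and in HU as [Ux HU]; exists U; repeat split; auto.
Qed.

Lemma sig_eq {X : Type} (A : X -> Prop) (z w : {x | A x}) : proj1_sig z = proj1_sig w -> z = w.
Proof. destruct z as [z hz], w as [w hw]; simpl; intros <-; f_equal; apply proof_irrelevance. Qed.

Section SubspaceFacts.
Context {X : Type} (T : topology X) (A : X -> Prop).

Lemma open_subspace (U : X -> Prop) : is_open T U -> is_open (subspace T A) (fun z => U (proj1_sig z)).
Proof. intros oU z Uz; exists U; auto. Qed.

Lemma regular_subspace : regular T -> regular (subspace T A).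
Proof.
  intros reg z F cF nFz.
  destruct (cF z nFz) as [V [oV [Vz HV]]].
  destruct (regular_shrink T V (proj1_sig z) reg oV Vz) as [W [oW [Wz HW]]].
  exists (fun w => W (proj1_sig w)), (fun w => ~ closure T W (proj1_sig w)).
  split; [apply open_subspace, oW|]; split; [apply (open_subspace (fun w => ~ closure T W w)), open_not_closure|].
  split; [exact Wz|]; split.
  - intros w Fw h; exact (HV w (HW _ h) Fw).
  - intros w Ww h; apply h; intros U oU Uw; eauto.
Qed.

Lemma hausdorff_subspace : hausdorff T -> hausdorff (subspace T A).
Proof.
  intros haus z w ne.
  destruct (haus (proj1_sig z) (proj1_sig w)) as [U [V [oU [oV [Uz [Vw HUV]]]]]].
  - intro E; apply ne, sig_eq, E.
  - exists (fun z => U (proj1_sig z)), (fun z => V (proj1_sig z)); repeat split; auto using open_subspace.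
    intros x; apply HUV.
Qed.

End SubspaceFacts.

Lemma hausdorff_prod {X Y : Type} (TX : topology X) (TY : topology Y) :
  hausdorff TX -> hausdorff TY -> hausdorff (prod_top TX TY).
Proof.
  intros hX hY [x y] [x' y'] ne.
  destruct (classic (x = x')) as [<-|nx].
  - destruct (hY y y') as [U [V [oU [oV [Ux [Vx HUV]]]]]]; [congruence|].
    exists (fun z => True /\ U (snd z)), (fun z => True /\ V (snd z)).
    split; [apply (open_box TX TY (fun _ => True)); [apply open_setT | auto]|].
    split; [apply (open_box TX TY (fun _ => True)); [apply open_setT | auto]|].
    repeat split; auto; intros z [_ h] [_ h']; eauto.
  - destruct (hX x x' nx) as [U [V [oU [oV [Ux [Vx HUV]]]]]].
    exists (fun z => U (fst z) /\ True), (fun z => V (fst z) /\ True).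
    split; [apply (open_box TX TY U (fun _ => True)); [auto | apply open_setT]|].
    split; [apply (open_box TX TY V (fun _ => True)); [auto | apply open_setT]|].
    repeat split; auto; intros z [h _] [h' _]; eauto.
Qed.

(** The given neighbourhood of [x] contains [s n] only for [n < N]; removing those terms that differ
    from [x] leaves a neighbourhood meeting [P] at most in [x], which yields both conclusions. *)
Lemma locally_finite_closed_discrete {X : Type} (T : topology X) (s : nat -> X) (P : X -> Prop) :
  hausdorff T -> (forall x, P x <-> exists n, x = s n) ->
  (forall x, exists U, is_open T U /\ U x /\ exists N, forall n, N <= n -> ~ U (s n)) ->
  is_closed T P /\ discrete_set T P.
Proof.
  intros haus HP lf.
  assert (H : forall x, exists U, is_open T U /\ U x /\ forall y, U y -> P y -> y = x).
  { intro x; destruct (lf x) as [U [oU [Ux [N HN]]]].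
    exists (fun y => U y /\ forall n, In n (seq 0 N) -> s n <> x -> y <> s n).
    split; [apply open_inter; [exact oU|]; apply open_forall_in; intros n _|].
    - destruct (classic (s n = x)) as [E|E].
      + apply (open_ext T (fun _ => True)); [apply open_setT | tauto].
      + apply (open_ext T (fun y => y <> s n)); [apply open_neq; auto | tauto].
    - split; [split; [auto | intros n _ h E; apply h; auto]|].
      intros y [Uy h] Py; apply HP in Py as [n ->]; apply NNPP; intro ne.
      destruct (le_lt_dec N n) as [hn|hn]; [exact (HN n hn Uy)|].
      apply (h n); auto; apply in_seq; lia. }
  split; [|intros x _; apply H].
  apply open_local; intros x nPx; destruct (H x) as [U [oU [Ux HU]]].
  exists U; repeat split; auto; intros y Uy Py; apply nPx; rewrite <- (HU y Uy Py); exact Py.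
Qed.

(** * Real-valued functions and Tychonoff separation *)

Section RealFunctions.
Context {X : Type} (T : topology X).

Lemma open_ball (f : X -> R) x eps : continuous T R_top f -> (0 < eps)%R ->
  is_open T (fun y => (Rabs (f y - f x) < eps)%R).
Proof.
  intros cf He; apply (cf (fun r => (Rabs (r - f x) < eps)%R)).
  intros r Hr; exists (eps - Rabs (r - f x))%R; split; [lra|].
  intros r' Hr'; revert Hr Hr'; unfold Rabs; repeat destruct Rcase_abs; lra.
Qed.

Lemma continuous_real (f : X -> R) :
  (forall x eps, (0 < eps)%R -> exists U, is_open T U /\ U x /\
     forall y, U y -> (Rabs (f x - f y) < eps)%R) -> continuous T R_top f.
Proof.
  intros H V oV; apply open_local; intros x Vx.
  destruct (oV _ Vx) as [eps [He HV]]; destruct (H x eps He) as [U [oU [Ux HU]]].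
  exists U; repeat split; auto.
Qed.

Lemma hausdorff_R : hausdorff R_top.
Proof.
  assert (ball : forall c eps, is_open R_top (fun r => (Rabs (r - c) < eps)%R)).
  { intros c eps r Hr; exists (eps - Rabs (r - c))%R; split; [lra|].
    intros r' Hr'; revert Hr Hr'; unfold Rabs; repeat destruct Rcase_abs; lra. }
  intros x y ne; assert (0 < Rabs (x - y))%R by (apply Rabs_pos_lt; lra).
  exists (fun r => Rabs (r - x) < Rabs (x - y) / 2)%R, (fun r => Rabs (r - y) < Rabs (x - y) / 2)%R.
  split; [apply ball|]; split; [apply ball|].
  replace (x - x)%R with 0%R by ring; replace (y - y)%R with 0%R by ring; rewrite Rabs_R0.
  repeat split; try lra.
  intros z; unfold Rabs; repeat destruct Rcase_abs; lra.
Qed.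

Lemma tychonoff_regular : tychonoff T -> regular T.
Proof.
  intros [_ H] x F cF nFx; destruct (H x F cF nFx) as [f [cf [fx fF]]].
  exists (fun y => Rabs (f y - f x) < 1 / 2)%R, (fun y => ~ Rabs (f y - f x) <= 1 / 2)%R.
  split; [apply open_ball; [auto | lra]|]; split.
  - apply open_local; intros y Hy; exists (fun z => Rabs (f z - f y) < Rabs (f y - f x) - 1 / 2)%R.
    apply Rnot_le_lt in Hy; split; [apply open_ball; [auto | lra]|].
    replace (f y - f y)%R with 0%R by ring; rewrite Rabs_R0; split; [lra|].
    intros z Hz; revert Hy Hz; unfold Rabs; repeat destruct Rcase_abs; lra.
  - replace (f x - f x)%R with 0%R by ring; rewrite Rabs_R0; repeat split; [lra| |intros; lra].
    intros z Fz; rewrite (fF z Fz), fx; unfold Rabs; destruct Rcase_abs; lra.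
Qed.

(** The definition of [tychonoff] does not bound the separating function, so it is truncated to the
    unit interval. *)
Lemma tychonoff_separation x U : tychonoff T -> is_open T U -> U x ->
  exists f : X -> R, continuous T R_top f /\ (forall y, (0 <= f y <= 1)%R) /\
    f x = 0%R /\ forall y, ~ U y -> f y = 1%R.
Proof.
  intros [_ H] oU Ux; destruct (H x (fun y => ~ U y)) as [f [cf [fx fU]]].
  - apply (open_ext T U); [exact oU | intro y; split; [tauto | apply NNPP]].
  - tauto.
  - exists (fun y => Rmax 0 (Rmin 1 (f y))); repeat split.
    + apply continuous_real; intros y eps He.
      exists (fun z => Rabs (f z - f y) < eps)%R; split; [apply open_ball; auto|].
      replace (f y - f y)%R with 0%R by ring; rewrite Rabs_R0; split; [lra|].
      intros z; unfold Rabs, Rmax, Rmin; repeat destruct Rle_dec; repeat destruct Rcase_abs; lra.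
    + apply Rmax_l.
    + apply Rmax_lub; [lra | apply Rmin_l].
    + rewrite fx; unfold Rmax, Rmin; repeat destruct Rle_dec; lra.
    + intros y Hy; rewrite (fU y Hy); unfold Rmax, Rmin; repeat destruct Rle_dec; lra.
Qed.

End RealFunctions.

(** * Factoring countable families of functions *)

Definition weighted_diff (u v : nat -> R) (n : nat) : R := (Rabs (u n - v n) / (INR n + 1))%R.

(** A supremum metric for the product topology of the Hilbert cube. [epsilon] makes it total; its
    value is controlled only where the supremum exists, as it does on [unit_seq]. *)
Definition seq_dist (u v : nat -> R) : R :=
  epsilon (inhabits 0%R) (is_lub (fun r => exists n, r = weighted_diff u v n)).

Definition unit_seq (u : nat -> R) : Prop := forall n, (0 <= u n <= 1)%R.

Lemma INR_succ_pos n : (0 < INR n + 1)%R.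
Proof. pose proof (pos_INR n); lra. Qed.

Lemma weighted_diff_le u v n r : (Rabs (u n - v n) <= r * (INR n + 1))%R -> (weighted_diff u v n <= r)%R.
Proof.
  intro H; unfold weighted_diff; pose proof (INR_succ_pos n).
  apply Rmult_le_reg_r with (INR n + 1)%R; [auto|]; field_simplify; lra.
Qed.

Lemma seq_dist_lub u v : unit_seq u -> unit_seq v ->
  is_lub (fun r => exists n, r = weighted_diff u v n) (seq_dist u v).
Proof.
  intros Hu Hv; unfold seq_dist; apply epsilon_spec.
  destruct (completeness (fun r => exists n, r = weighted_diff u v n)) as [m Hm]; [| |eauto].
  - exists 1%R; intros r [n ->]; apply weighted_diff_le; specialize (Hu n); specialize (Hv n).
    pose proof (pos_INR n); unfold Rabs; destruct Rcase_abs; lra.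
  - exists (weighted_diff u v 0), 0; auto.
Qed.

Lemma seq_dist_ge u v n : unit_seq u -> unit_seq v -> (weighted_diff u v n <= seq_dist u v)%R.
Proof. intros Hu Hv; apply (seq_dist_lub u v Hu Hv); eauto. Qed.

Lemma seq_dist_le u v r : unit_seq u -> unit_seq v ->
  (forall n, weighted_diff u v n <= r)%R -> (seq_dist u v <= r)%R.
Proof. intros Hu Hv H; apply (seq_dist_lub u v Hu Hv); intros s [n ->]; auto. Qed.

Lemma weighted_diff_nonneg u v n : (0 <= weighted_diff u v n)%R.
Proof.
  unfold weighted_diff; pose proof (INR_succ_pos n).
  apply Rmult_le_pos; [apply Rabs_pos | left; apply Rinv_0_lt_compat; auto].
Qed.

Lemma seq_dist_metric (A : (nat -> R) -> Prop) : (forall u, A u -> unit_seq u) ->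
  is_metric (fun u v : {u | A u} => seq_dist (proj1_sig u) (proj1_sig v)).
Proof.
  intro HA; repeat split.
  - intros [u Au] [v Av]; simpl; pose proof (seq_dist_ge u v 0 (HA u Au) (HA v Av)).
    pose proof (weighted_diff_nonneg u v 0); lra.
  - destruct x as [u Au], y as [v Av]; simpl; intro E; apply sig_eq; simpl.
    apply functional_extensionality; intro n.
    pose proof (seq_dist_ge u v n (HA u Au) (HA v Av)) as h; rewrite E in h.
    pose proof (weighted_diff_nonneg u v n) as h'; pose proof (INR_succ_pos n) as hn.
    assert (E' : weighted_diff u v n = 0%R) by lra; unfold weighted_diff in E'.
    assert (Rabs (u n - v n) = 0)%R.
    { replace (Rabs (u n - v n)) with (Rabs (u n - v n) / (INR n + 1) * (INR n + 1))%R by (field; lra).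
      rewrite E'; ring. }
    apply NNPP; intro ne; apply (Rabs_no_R0 (u n - v n)); lra.
  - intros <-; destruct x as [u Au]; simpl; apply Rle_antisym.
    + apply seq_dist_le; auto; intro n; apply weighted_diff_le.
      replace (u n - u n)%R with 0%R by ring; rewrite Rabs_R0; lra.
    + pose proof (seq_dist_ge u u 0 (HA u Au) (HA u Au)); pose proof (weighted_diff_nonneg u u 0); lra.
  - intros [u Au] [v Av]; simpl.
    assert (E : weighted_diff u v = weighted_diff v u).
    { apply functional_extensionality; intro n; unfold weighted_diff; rewrite Rabs_minus_sym; auto. }
    unfold seq_dist; rewrite E; auto.
  - intros [u Au] [v Av] [w Aw]; simpl; apply seq_dist_le; auto; intro n.
    pose proof (seq_dist_ge u v n (HA u Au) (HA v Av)).
    pose proof (seq_dist_ge v w n (HA v Av) (HA w Aw)).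
    enough (weighted_diff u w n <= weighted_diff u v n + weighted_diff v w n)%R by lra.
    unfold weighted_diff; rewrite <- Rdiv_plus_distr; pose proof (INR_succ_pos n).
    apply Rmult_le_compat_r; [left; apply Rinv_0_lt_compat; auto|].
    replace (u n - w n)%R with ((u n - v n) + (v n - w n))%R by ring; apply Rabs_triang.
Qed.

(* The target is the set of sequences [(h n x)_n] inside the Hilbert cube. *)
Lemma countable_family_sep_metrizable {X : Type} (T : topology X) (t : nat -> X) (h : nat -> X -> R) :
  dense T (fun x => exists n, x = t n) ->
  (forall n, continuous T R_top (h n)) -> (forall n x, (0 <= h n x <= 1)%R) ->
  exists (Y : Type) (TY : topology Y) (G : X -> Y), sep_metrizable TY /\ continuous T TY G /\
    forall x x', G x = G x' -> forall n, h n x = h n x'.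
Proof.
  intros Ht ch Hh.
  pose (A := fun u : nat -> R => exists x, u = fun n => h n x).
  assert (HA : forall u, A u -> unit_seq u) by (intros u [x ->] n; apply Hh).
  pose (G := fun x => exist A (fun n => h n x) (ex_intro _ x eq_refl)).
  pose (d := fun u v : {u | A u} => seq_dist (proj1_sig u) (proj1_sig v)).
  assert (cG : continuous T (metric_top d) G).
  { intros V oV; apply open_local; intros x Vx; destruct (oV _ Vx) as [eps [He HV]].
    (* From [N] on the weight [1/(n+1)] alone keeps the contribution below [eps/2], so only the
       first [N] coordinates have to be close. *)
    destruct (archimed_cor1 (eps / 2)) as [N [HN HN0]]; [lra|].
    exists (fun y => forall n, In n (seq 0 N) -> (Rabs (h n y - h n x) < eps / 2)%R); split.
    - apply open_forall_in; intros n _; apply open_ball; [auto | lra].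
    - split; [intros n _; replace (h n x - h n x)%R with 0%R by ring; rewrite Rabs_R0; lra|].
      intros y Hy; apply HV; unfold d; apply Rle_lt_trans with (eps / 2)%R; [|lra].
      apply seq_dist_le; try (apply HA; simpl; eexists; eauto); intro n; apply weighted_diff_le; simpl.
      pose proof (pos_INR n); rewrite Rabs_minus_sym; destruct (le_lt_dec N n) as [hn|hn].
      + apply Rle_trans with 1%R.
        * pose proof (Hh n x); pose proof (Hh n y); unfold Rabs; destruct Rcase_abs; lra.
        * apply le_INR in hn; apply lt_INR in HN0; simpl in HN0.
          apply Rmult_lt_compat_r with (r := INR N) in HN; [|auto]; rewrite Rinv_l in HN by lra.
          apply Rle_trans with (eps / 2 * INR N)%R; [lra | apply Rmult_le_compat_l; lra].
      + assert (Hn : (Rabs (h n y - h n x) < eps / 2)%R) by (apply Hy, in_seq; lia).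
        apply Rle_trans with (eps / 2 * 1)%R; [lra | apply Rmult_le_compat_l; lra]. }
  exists {u | A u}, (metric_top d), G; split; [split|split; [exact cG|]].
  - exists (fun u => exists n, u = G (t n)); split.
    (* Each point of the set gets some index [n] with [u = G (t n)], and this index determines the
       point. *)
    + exists (fun u => epsilon (inhabits 0) (fun n => u = G (t n))).
      intros u v Hu Hv E; apply epsilon_spec with (i := inhabits 0) in Hu, Hv.
      rewrite Hu, Hv, E; auto.
    + intros [u [x ->]] U oU Uu; destruct (Ht x _ (cG U oU) Uu) as [y [Uy [n ->]]]; eauto.
  - exists d; split; [apply (seq_dist_metric A HA) | tauto].
  - intros x x' E n; apply (f_equal (fun u => proj1_sig u n)) in E; exact E.
Qed.

Lemma accumulation_unbounded {X : Type} (T : topology X) (B : X -> Prop) (s : nat -> X) x U :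
  accumulation_point T B x -> (forall y, B y -> exists n, y = s n) ->
  is_open T U -> U x -> unbounded (fun n => U (s n) /\ B (s n)).
Proof.
  intros Hx HB oU Ux; apply NNPP; intro h; apply not_unbounded in h as [N HN].
  apply (Hx U oU Ux); exists (map s (seq 0 N)); intros y [Uy By].
  destruct (HB y By) as [n ->]; apply in_map, in_seq; split; [lia|].
  apply NNPP; intro; apply (HN n); [lia | auto].
Qed.

Lemma unbounded_infinite {A : Type} (s : nat -> A) (P : A -> Prop) :
  (forall n m, s n = s m -> n = m) -> unbounded (fun n => P (s n)) -> ~ finite_set P.
Proof.
  intros inj u fP; destruct (finite_set_bounded P s inj fP) as [N HN].
  destruct (u N) as [n [h1 h2]]; exact (HN n h1 h2).
Qed.

(** * Dense embeddings of the bicyclic semigroup *)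

Section Bicyclic.
Context {S : Type} (T : topology S) (mul : S -> S -> S) (j : nat * nat -> S).
Hypothesis Hassoc : forall x y z, mul x (mul y z) = mul (mul x y) z.
Hypothesis Hcont : continuous (prod_top T T) T (fun z => mul (fst z) (snd z)).
Hypothesis Hhaus : hausdorff T.
Hypothesis Hjinj : forall c d, j c = j d -> c = d.
Hypothesis Hjhom : forall c d, j (bic c d) = mul (j c) (j d).
Hypothesis Hjdense : dense T (fun x => exists c, x = j c).

Lemma continuous_id : continuous T T (fun x => x).
Proof. intros V oV; exact oV. Qed.

Lemma continuous_const {Y : Type} (T' : topology Y) (y : Y) : continuous T T' (fun _ => y).
Proof. intros V oV; apply open_local; intros x Vy; exists (fun _ => True); repeat split; auto; apply open_setT. Qed.

Lemma continuous_mul (f g : S -> S) :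
  continuous T T f -> continuous T T g -> continuous T T (fun x => mul (f x) (g x)).
Proof. intros cf cg V oV; exact (continuous_pair _ _ _ _ _ cf cg _ (Hcont V oV)). Qed.

Lemma continuous_mull x : continuous T T (fun y => mul x y).
Proof. apply continuous_mul; [apply continuous_const | apply continuous_id]. Qed.

Lemma continuous_mulr x : continuous T T (fun y => mul y x).
Proof. apply continuous_mul; [apply continuous_id | apply continuous_const]. Qed.

Lemma mul_nbhd x y W : is_open T W -> W (mul x y) ->
  exists U V, is_open T U /\ is_open T V /\ U x /\ V y /\ forall a b, U a -> V b -> W (mul a b).
Proof.
  intros oW Wxy; destruct (Hcont W oW (x, y) Wxy) as [U [V H]]; exists U, V; exact H.
Qed.

Local Ltac bicyclic :=
  rewrite <- ?Hjhom; unfold bic;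
  repeat (match goal with |- context [Nat.leb ?a ?b] => destruct (Nat.leb_spec a b) end;
          cbv beta iota);
  f_equal; f_equal; lia.

(* If [E_m x <> x] and [x E_n <> x], where [E_k = p^k q^k], these inequalities define a neighbourhood
   of [x] with finite trace on the dense set [C(p,q)], so that [x] belongs to this trace. *)
Lemma corner_finite m n x : mul (j (m, m)) x <> x -> mul x (j (n, n)) <> x ->
  In x (map j (list_prod (seq 0 m) (seq 0 n))).
Proof.
  intros hm hn; apply NNPP; intro nx.
  destruct (closure_notin T Hhaus _ _ x (Hjdense x) nx) with
    (U := fun x => mul (j (m, m)) x <> x /\ mul x (j (n, n)) <> x) as [y [[h1 h2] [[[i k] ->] h3]]].
  - apply open_inter; apply (open_eq_compl T T); auto using continuous_id, continuous_mull, continuous_mulr.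
  - auto.
  (* [E_m] fixes [p^i q^k] on the left once [m <= i], and [E_n] fixes it on the right once
     [n <= k]. *)
  - apply h3, in_map, in_prod; apply in_seq; split; try lia; apply NNPP; intro h; simpl in h.
    + apply h1; bicyclic.
    + apply h2; bicyclic.
Qed.

Lemma isolated c : is_open T (fun x => x = j c).
Proof.
  destruct c as [m n].
  pose (L := map j (list_prod (seq 0 (m + 1)) (seq 0 (n + 1)))).
  (* The shift by one matters: [E_m] and [E_n] fix [p^m q^n], whereas [E_(m+1)] on the left and
     [E_(n+1)] on the right send it to [p^(m+1) q^(n+1)]. *)
  pose (U := fun x => mul (j (m + 1, m + 1)) x <> x /\ mul x (j (n + 1, n + 1)) <> x).
  assert (oU : is_open T U).
  { apply open_inter; apply (open_eq_compl T T); auto using continuous_id, continuous_mull, continuous_mulr. }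
  apply (open_ext T (fun x => U x /\ forall y, In y L -> y <> j (m, n) -> x <> y)).
  - apply open_inter; [exact oU|]; apply open_forall_in; intros y _.
    destruct (classic (y = j (m, n))) as [E|E].
    + apply (open_ext T (fun _ => True)); [apply open_setT | tauto].
    + apply (open_ext T (fun x => x <> y)); [apply open_neq; auto | tauto].
  - intro x; split.
    + intros [Ux H]; apply NNPP; intro h; exact (H x (corner_finite _ _ x (proj1 Ux) (proj2 Ux)) h eq_refl).
    + intros ->; split; [|intros y _ h E; apply h; auto].
      split; rewrite <- Hjhom; intro E; apply Hjinj in E; revert E; unfold bic;
        destruct (Nat.leb_spec m (m + 1)), (Nat.leb_spec (n + 1) n); intro E; inversion E; lia.
Qed.

Lemma open_bicyclic (A : nat * nat -> Prop) : is_open T (fun x => exists c, A c /\ x = j c).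
Proof.
  apply open_local; intros x [c [Ac ->]]; exists (fun x => x = j c).
  split; [apply isolated|]; split; [auto | intros y ->; eauto].
Qed.

Lemma bicyclic_or_outside x : (exists c, x = j c) \/ outside_C j x.
Proof.
  destruct (classic (exists c, x = j c)) as [h|h]; [auto | right; intros c E; eauto].
Qed.

Lemma accumulation_outside B x : accumulation_point T B x -> outside_C j x.
Proof.
  intros Hx c ->; apply (Hx _ (isolated c) eq_refl); exists (j c :: nil); intros y [-> _]; left; auto.
Qed.

(** * Convergence of the idempotents [p^n q^n] *)

Definition EC (x : S) : Prop := exists n, x = j (n, n).

Lemma EC_inj n m : j (n, n) = j (m, m) -> n = m.
Proof. intro E; apply Hjinj in E; inversion E; auto. Qed.

(** [f] lies in the closure of every tail of [E_C], and [E_n E_k = E_k = E_k E_n] for [k >= n]. *)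
Lemma accumulation_absorbs f n : accumulation_point T EC f ->
  mul (j (n, n)) f = f /\ mul f (j (n, n)) = f.
Proof.
  intro Hf.
  assert (cl : closure T (fun x => exists k, n <= k /\ x = j (k, k)) f).
  { intros U oU Uf.
    destruct (accumulation_unbounded T EC (fun k => j (k, k)) f U Hf) with (N := n) as [k [h1 [h2 _]]]; auto.
    eauto. }
  split.
  - apply (eq_on_closure T T (fun x => mul (j (n, n)) x) (fun x => x) _ f Hhaus
             (continuous_mull _) continuous_id) with (2 := cl).
    intros y [k [Hk ->]]; bicyclic.
  - apply (eq_on_closure T T (fun x => mul x (j (n, n))) (fun x => x) _ f Hhaus
             (continuous_mulr _) continuous_id) with (2 := cl).
    intros y [k [Hk ->]]; bicyclic.
Qed.

Lemma accumulation_closure B x : accumulation_point T B x -> closure T B x.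
Proof.
  intros Hx U oU Ux; apply NNPP; intro h; apply (Hx U oU Ux); exists nil; intros y Hy; apply h; eauto.
Qed.

(** The product [e f] is evaluated twice: letting [E_n] tend to [f] in [e E_n = e] gives [e], and
    letting [E_n] tend to [e] in [E_n f = f] gives [f]. *)
Lemma accumulation_unique e f : accumulation_point T EC e -> accumulation_point T EC f -> e = f.
Proof.
  intros He Hf; transitivity (mul e f).
  - apply (eq_on_closure T T (fun _ => e) (fun x => mul e x) EC f Hhaus
             (continuous_const _ _) (continuous_mull _)).
    + intros y [n ->]; symmetry; apply accumulation_absorbs; auto.
    + apply accumulation_closure, Hf.
  - apply (eq_on_closure T T (fun x => mul x f) (fun _ => f) EC e Hhaus
             (continuous_mulr _) (continuous_const _ _)).
    + intros y [n ->]; apply accumulation_absorbs; auto.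
    + apply accumulation_closure, He.
Qed.

(** If infinitely many [E_n] stayed outside a neighbourhood of [e], they would accumulate at a point
    which by uniqueness is again [e]. *)
Lemma EC_converges : countably_compact_at T EC ->
  exists e, accumulation_point T EC e /\ converges T (fun n => j (n, n)) e.
Proof.
  intro cc.
  assert (Hsub : forall I, unbounded I -> exists e, accumulation_point T (fun x => exists n, I n /\ x = j (n, n)) e).
  { intros I uI; apply cc.
    - intros x [n [_ ->]]; exists n; auto.
    - apply (unbounded_infinite (fun n => j (n, n)) _ EC_inj).
      intro N; destruct (uI N) as [n [h1 h2]]; eauto 6. }
  assert (mono : forall I f, accumulation_point T (fun x => exists n, I n /\ x = j (n, n)) f ->
    accumulation_point T EC f).
  { intros I f Hf U oU Uf h; apply (Hf U oU Uf).
    revert h; apply finite_set_sub; intros x [Ux [n [_ ->]]]; split; [auto | exists n; auto]. }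
  destruct (Hsub (fun _ => True)) as [e He]; [intro N; exists N; auto|].
  apply mono in He; exists e; split; [exact He|].
  intros U oU Ue; apply NNPP; intro h.
  destruct (Hsub (fun n => ~ U (j (n, n)))) as [f Hf].
  { intro N; apply NNPP; intro h'; apply h; exists N; intros n Hn; apply NNPP; intro; eauto. }
  pose proof (accumulation_unique e f He (mono _ f Hf)) as <-.
  destruct (accumulation_closure _ _ Hf U oU Ue) as [y [Uy [n [nU ->]]]]; contradiction.
Qed.

Variable e : S.
Hypothesis Hacc : accumulation_point T EC e.
Hypothesis Hlim : converges T (fun n => j (n, n)) e.

Lemma e_outside : outside_C j e.
Proof. exact (accumulation_outside _ _ Hacc). Qed.

Lemma e_closure : closure T EC e.
Proof. exact (accumulation_closure _ _ Hacc). Qed.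

Lemma closure_EC x : closure T EC x -> EC x \/ x = e.
Proof.
  intro Hx; apply NNPP; intro h.
  assert (ne : e <> x) by (intro; apply h; auto).
  destruct (Hhaus _ _ ne) as [U [V [oU [oV [Ue [Vx HUV]]]]]].
  destruct (Hlim U oU Ue) as [N HN].
  destruct (closure_notin T Hhaus EC (map (fun n => j (n, n)) (seq 0 N)) x Hx) with (U := V)
    as [y [Vy [[n ->] hn]]]; auto.
  - intro h'; apply in_map_iff in h' as [n [<- _]]; apply h; left; exists n; auto.
  - apply (HUV (j (n, n))); auto; apply HN.
    apply NNPP; intro; apply hn; apply (in_map (fun n => j (n, n))), in_seq; lia.
Qed.

Lemma compact_closure_EC : compact_set T (closure T EC).
Proof.
  intros F oF cF.
  assert (cE : forall n, exists U, F U /\ U (j (n, n))).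
  { intro n; apply cF; intros U oU Un; exists (j (n, n)); split; [auto | exists n; auto]. }
  destruct (cF e e_closure) as [U [FU Ue]]; destruct (Hlim U (oF U FU) Ue) as [N HN].
  assert (exists l, (forall V, In V l -> F V) /\ forall n, n < N -> exists V, In V l /\ V (j (n, n)))
    as [l [Fl Hl]].
  { clear HN; induction N as [|N [l [Fl Hl]]].
    - exists nil; split; [intros V [] | intros n Hn; lia].
    - destruct (cE N) as [V [FV VN]]; exists (V :: l); split.
      + intros W [<-|h]; auto.
      + intros n Hn; destruct (Nat.eq_dec n N) as [->|]; [exists V; simpl; auto|].
        destruct (Hl n) as [W [h1 h2]]; [lia | exists W; simpl; auto]. }
  exists (U :: l); split; [intros V [<-|h]; auto|].
  intros x Hx; destruct (closure_EC x Hx) as [[n ->] | ->]; [|exists U; simpl; auto].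
  destruct (le_lt_dec N n) as [h|h].
  - exists U; simpl; auto.
  - destruct (Hl n h) as [V [h1 h2]]; exists V; simpl; auto.
Qed.

Lemma nonisolated_closure_EC : nonisolated_in T (closure T EC) e.
Proof.
  split; [exact e_closure|]; intros U oU Ue; destruct (e_closure U oU Ue) as [y [Uy [n ->]]].
  exists (j (n, n)); split; [auto|]; split; [|intro E; exact (e_outside _ (eq_sym E))].
  intros V oV Vn; exists (j (n, n)); split; [auto | exists n; auto].
Qed.

Lemma nonisolated_closure_EC_unique x : nonisolated_in T (closure T EC) x -> x = e.
Proof.
  intros [Hx H]; destruct (closure_EC x Hx) as [[n ->]|]; [|auto].
  destruct (H _ (isolated (n, n)) eq_refl) as [y [h1 [_ h2]]]; contradiction.
Qed.

(** * The central idempotent, the ideal [M] and the powers of [a] *)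

Lemma e_idem : mul e e = e.
Proof.
  apply (eq_on_closure T T (fun x => mul x e) (fun _ => e) EC e Hhaus
           (continuous_mulr _) (continuous_const _ _)); [|exact e_closure].
  intros y [n ->]; apply accumulation_absorbs, Hacc.
Qed.

(** By density it suffices to treat [p^m q^n]. There [p^m q^n E_(n+k) = p^(m+k) q^(n+k) = E_(m+k)
    p^m q^n], so the sequences tending to the two products share their late terms. *)
Lemma e_central x : mul x e = mul e x.
Proof.
  apply (eq_on_closure T T (fun x => mul x e) (fun x => mul e x) _ x Hhaus
           (continuous_mulr _) (continuous_mull _)) with (2 := Hjdense x).
  intros y [[m n] ->].
  apply NNPP; intro ne; destruct (Hhaus _ _ ne) as [U [V [oU [oV [Ux [Vx HUV]]]]]].
  destruct (converges_image T T _ _ _ (continuous_mull (j (m, n))) Hlim U oU Ux) as [N HN].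
  destruct (converges_image T T _ _ _ (continuous_mulr (j (m, n))) Hlim V oV Vx) as [N' HN'].
  pose (k := N + N' + m + n).
  apply (HUV (j (m + k, n + k))).
  - replace (j (m + k, n + k)) with (mul (j (m, n)) (j (n + k, n + k))) by bicyclic; apply HN; lia.
  - replace (j (m + k, n + k)) with (mul (j (m + k, m + k)) (j (m, n))) by bicyclic; apply HN'; lia.
Qed.

Lemma mul_e_outside x : outside_C j (mul x e).
Proof.
  intros [m n] E.
  assert (E' : mul (j (m, n)) e = j (m, n)) by (rewrite <- E, <- Hassoc, e_idem; auto).
  destruct (converges_image T T _ _ _ (continuous_mull (j (m, n))) Hlim _ (isolated (m, n)) E') as [N HN].
  (* Isolation forces [p^m q^n E_k = p^m q^n] for large [k], but for [k > n] the left side ends in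
     [q^k]. *)
  specialize (HN (N + n + 1) ltac:(lia)); rewrite <- Hjhom in HN; apply Hjinj in HN.
  revert HN; unfold bic; destruct (Nat.leb_spec (N + n + 1) n); intro E1; inversion E1; lia.
Qed.

(** By [corner_finite] no pair [E_m], [E_n] can move [x] on both sides, so all of them fix [x] on
    one and the same side. The limit gives [x e = x] or [e x = x], and [e] is central. *)
Lemma mul_e_id x : outside_C j x -> mul x e = x.
Proof.
  intro Hx.
  assert (H : forall m n, mul (j (m, m)) x = x \/ mul x (j (n, n)) = x).
  { intros m n; apply NNPP; intro h.
    assert (h' : In x (map j (list_prod (seq 0 m) (seq 0 n)))) by (apply corner_finite; tauto).
    apply in_map_iff in h' as [c [h' _]]; exact (Hx c (eq_sym h')). }
  destruct (classic (forall n, mul x (j (n, n)) = x)) as [h|h].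
  - apply (eq_on_closure T T (fun y => mul x y) (fun _ => x) EC e Hhaus
           (continuous_mull _) (continuous_const _ _)); [|exact e_closure].
    intros y [n ->]; auto.
  - apply not_all_ex_not in h as [n Hn]; rewrite e_central.
    apply (eq_on_closure T T (fun y => mul y x) (fun _ => x) EC e Hhaus
           (continuous_mulr _) (continuous_const _ _)); [|exact e_closure].
    intros y [m ->]; destruct (H m n); tauto.
Qed.

Lemma e_mul_id x : outside_C j x -> mul e x = x.
Proof. rewrite <- e_central; apply mul_e_id. Qed.

Lemma mul_e_mul x y : mul (mul x y) e = mul (mul x e) (mul y e).
Proof. rewrite <- (Hassoc x e), (Hassoc e), <- (e_central y), <- (Hassoc y), e_idem, Hassoc; auto. Qed.

Lemma mul_outside_r x y : outside_C j y -> outside_C j (mul x y).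
Proof. intro Hy; rewrite <- (mul_e_id y Hy), Hassoc; apply mul_e_outside. Qed.

Lemma mul_outside_l x y : outside_C j y -> outside_C j (mul y x).
Proof.
  intro Hy; rewrite <- (mul_e_id y Hy), <- Hassoc, <- e_central, Hassoc; apply mul_e_outside.
Qed.

(* [apow n m] is [a^(n-m)]. *)
Definition apow (n m : nat) : S := mul (j (n, m)) e.

Lemma apow_mul n m i k : mul (apow n m) (apow i k) = apow (n + i) (m + k).
Proof.
  unfold apow; rewrite <- mul_e_mul.
  (* In [C] the product of [p^n q^m] and [p^i q^k] need not be [p^(n+i) q^(m+k)], but the two agree
     after right multiplication by [E_r] with [r = m + k + i], and [e] absorbs [E_r]. *)
  transitivity (mul (mul (j (n, m)) (j (i, k))) (mul (j (m + k + i, m + k + i)) e)).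
  { f_equal; symmetry; apply accumulation_absorbs, Hacc. }
  transitivity (mul (j (n + i, m + k)) (mul (j (m + k + i, m + k + i)) e)).
  - rewrite !Hassoc; f_equal; bicyclic.
  - f_equal; apply accumulation_absorbs, Hacc.
Qed.

Lemma apow_diag n : apow n n = e.
Proof. apply accumulation_absorbs, Hacc. Qed.

Lemma apow_cancel n m k : apow (n + k) (m + k) = apow n m.
Proof. rewrite <- apow_mul, apow_diag; unfold apow; rewrite <- Hassoc, e_idem; auto. Qed.

Lemma apow_eq n m i k : n + k = i + m -> apow n m = apow i k.
Proof.
  intro E; rewrite <- (apow_cancel n m k), <- (apow_cancel i k m), E; f_equal; lia.
Qed.

Lemma apow_outside n m : outside_C j (apow n m).
Proof. apply mul_e_outside. Qed.

Lemma npow_apow i k n : npow mul e (apow i k) n = apow (n * i) (n * k).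
Proof.
  induction n as [|n IH]; simpl; [symmetry; apply apow_diag | rewrite IH; apply apow_mul].
Qed.

Lemma zpow_apow z n m : z = (Z.of_nat n - Z.of_nat m)%Z -> zpow mul e (apow 1 0) (apow 0 1) z = apow n m.
Proof.
  intros ->; destruct (Z.of_nat n - Z.of_nat m)%Z eqn:E; simpl;
    rewrite ?npow_apow, <- ?(apow_diag 0); apply apow_eq; lia.
Qed.

Lemma apow_dense x : outside_C j x -> closure T (fun y => exists n m, y = apow n m) x.
Proof.
  intros Hx U oU Ux; rewrite <- (mul_e_id x Hx) in Ux.
  destruct (Hjdense x _ (continuous_mulr e U oU) Ux) as [y [Uy [[n m] ->]]].
  exists (apow n m); eauto.
Qed.

Lemma j_converges n m : converges T (fun i => j (n + i, m + i)) (apow n m).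
Proof.
  intros U oU Ug; destruct (converges_image T T _ _ _ (continuous_mull (j (n, m))) Hlim U oU Ug) as [N HN].
  exists N; intros i Hi; specialize (HN (m + i) ltac:(lia)).
  replace (j (n + i, m + i)) with (mul (j (n, m)) (j (m + i, m + i))) by bicyclic; exact HN.
Qed.


(** * Regularity, and recovery of the topology of [S] from [M] *)

(** A separation in [M] is pulled back along the retraction [x |-> x e]. Points of [C] are isolated,
    so those of [F] can be added to one side, while [F] is removed from the other. *)
Lemma regular_from_outside : regular (subspace T (outside_C j)) -> regular T.
Proof.
  intros reg x F cF nFx; destruct (bicyclic_or_outside x) as [[c ->]|Hx].
  - exists (fun x => x = j c), (fun x => x <> j c); split; [apply isolated|].
    split; [apply open_neq; auto|]; repeat split; [|auto].
    intros z Fz ->; contradiction.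
  - destruct (reg (exist _ x Hx) (fun z => F (proj1_sig z))) as [U [V [oU [oV [Ux [FV HUV]]]]]].
    + exact (open_subspace T (outside_C j) (fun z => ~ F z) cF).
    + exact nFx.
    + pose (pi := fun x => exist (outside_C j) (mul x e) (mul_e_outside x)).
      assert (Epi : forall y (Hy : outside_C j y), pi y = exist _ y Hy).
      { intros y Hy; apply sig_eq, mul_e_id, Hy. }
      assert (cpi : continuous T (subspace T (outside_C j)) pi).
      { intros W oW; apply open_local; intros y Wy; destruct (oW _ Wy) as [W' [oW' [Wy' HW']]].
        exists (fun z => W' (mul z e)); split; [apply (continuous_mulr e), oW'|]; split; [exact Wy'|].
        intros z Wz; apply HW'; exact Wz. }
      exists (fun y => U (pi y) /\ ~ F y), (fun y => V (pi y) \/ exists c, F (j c) /\ y = j c).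
      split; [apply open_inter; [apply cpi, oU | exact cF]|].
      split; [apply open_or; [apply cpi, oV | apply open_bicyclic]|].
      split; [rewrite (Epi x Hx); auto|]; split.
      * intros z Fz; destruct (bicyclic_or_outside z) as [[c ->]|Hz]; [eauto|].
        left; rewrite (Epi z Hz); apply FV, Fz.
      * intros z [Uz nFz] [Vz|[c [Fc ->]]]; [exact (HUV _ Uz Vz) | contradiction].
Qed.

(** Take [V] with closure inside [U]. Infinitely many exceptional [c] would accumulate at some [y]
    in [M]; as [y = y e] is in the closure of [V], it is in [U], and so is some exceptional
    [j c]. *)
Lemma exceptional_finite x U : regular T -> countably_compact_at T (fun x => exists c, x = j c) ->
  outside_C j x -> is_open T U -> U x ->
  exists V, is_open T V /\ V x /\ (forall y, V y -> U y) /\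
    finite_set (fun c => V (mul (j c) e) /\ ~ U (j c)).
Proof.
  intros reg cc Hx oU Ux; destruct (regular_shrink T U x reg oU Ux) as [V [oV [Vx HV]]].
  exists V; split; [exact oV|]; split; [exact Vx|]; split.
  { intros y Vy; apply HV; intros W oW Wy; eauto. }
  apply NNPP; intro inf.
  destruct (cc (fun y => exists c, (V (mul (j c) e) /\ ~ U (j c)) /\ y = j c)) as [y Hy].
  - intros y [c [_ ->]]; eauto.
  - intros [l Hl]; apply inf.
    (* The finite list is carried back along the injection [j]; the default [(0, 0)] is harmless,
       being taken only off the image. *)
    exists (map (fun y => epsilon (inhabits (0, 0)) (fun c => y = j c)) l); intros c Hc.
    apply in_map_iff; exists (j c); split; [|eauto].
    symmetry; apply Hjinj, epsilon_spec; eauto.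
  - assert (Hy' : outside_C j y) by exact (accumulation_outside _ _ Hy).
    apply accumulation_closure in Hy.
    assert (Uy : U y).
    { apply HV; intros W oW Wy; rewrite <- (mul_e_id y Hy') in Wy.
      destruct (Hy _ (continuous_mulr e W oW) Wy) as [z [Wz [c [[Vc _] ->]]]]; eauto. }
    destruct (Hy U oU Uy) as [z [Uz [c [[_ nU] ->]]]]; contradiction.
Qed.

(** The identity of [S], read with [C] and [M] identified with their copies in the space built from
    [alpha_top]. *)
Definition cup_map (x : S) : option (nat * nat) * S :=
  match excluded_middle_informative (exists c, x = j c) with
  | left h => (Some (proj1_sig (constructive_indefinite_description _ h)), mul x e)
  | right _ => (None, x)
  end.

Lemma cup_map_bicyclic c : cup_map (j c) = (Some c, mul (j c) e).
Proof.
  unfold cup_map; destruct excluded_middle_informative as [h|h]; [|exfalso; eauto].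
  destruct constructive_indefinite_description as [d Hd]; simpl.
  apply Hjinj in Hd as <-; auto.
Qed.

Lemma cup_map_outside x : outside_C j x -> cup_map x = (None, x).
Proof.
  intro Hx; unfold cup_map; destruct excluded_middle_informative as [[c h]|h]; [|auto].
  destruct (Hx c h).
Qed.

Lemma cup_map_mul x y : cup_map (mul x y) = cup_mul mul j (fun y => mul y e) (cup_map x) (cup_map y).
Proof.
  destruct (bicyclic_or_outside x) as [[c ->]|Hx], (bicyclic_or_outside y) as [[d ->]|Hy].
  - rewrite <- Hjhom, !cup_map_bicyclic; auto.
  - rewrite (cup_map_outside _ (mul_outside_r _ _ Hy)), cup_map_bicyclic, cup_map_outside by auto.
    simpl; rewrite <- Hassoc, (e_mul_id y Hy); auto.
  - rewrite (cup_map_outside _ (mul_outside_l _ _ Hx)), cup_map_bicyclic, cup_map_outside by auto.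
    simpl; rewrite e_central, Hassoc, mul_e_id by auto; auto.
  - rewrite !cup_map_outside by auto using mul_outside_l; auto.
Qed.

Lemma cup_map_continuous : continuous T (prod_top (alpha_top (nat * nat)) T) cup_map.
Proof.
  intros W oW; apply open_local; intros x Wx.
  destruct (bicyclic_or_outside x) as [[c ->]|Hx].
  - exists (fun y => y = j c); split; [apply isolated|]; split; [auto | intros y ->; auto].
  - rewrite (cup_map_outside x Hx) in Wx.
    destruct (oW _ Wx) as [A [U [oA [oU [An [Ux H]]]]]]; destruct (oA An) as [l Hl]; simpl in Ux.
    exists (fun y => U (mul y e) /\ ~ In y (map j l)).
    split; [apply open_inter; [apply (continuous_mulr e), oU | apply open_notin; auto]|].
    split; [split; [rewrite mul_e_id; auto|]|].
    + intro h; apply in_map_iff in h as [c [h _]]; exact (Hx c (eq_sym h)).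
    + intros y [Uy ny]; destruct (bicyclic_or_outside y) as [[d ->]|Hy].
      * rewrite cup_map_bicyclic; apply H; [apply Hl; intro; apply ny, in_map; auto | exact Uy].
      * rewrite cup_map_outside by auto; rewrite mul_e_id in Uy by auto; auto.
Qed.

Lemma cup_map_embedding : regular T -> countably_compact_at T (fun x => exists c, x = j c) ->
  embedding T (prod_top (alpha_top (nat * nat)) T) cup_map.
Proof.
  intros reg cc; split; [|split; [exact cup_map_continuous|]].
  - intros x y; destruct (bicyclic_or_outside x) as [[c ->]|Hx], (bicyclic_or_outside y) as [[d ->]|Hy];
      rewrite ?cup_map_bicyclic, ?cup_map_outside by auto; congruence.
  - intros U oU.
    (* The largest open set whose preimage lies in [U]; it remains to find one suitable [W] around
       each image point. *)
    exists (fun z => exists W, (is_open (prod_top (alpha_top (nat * nat)) T) W /\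
      forall x, W (cup_map x) -> U x) /\ W z).
    split; [apply open_bigU; intros W [oW _]; exact oW|].
    intro x; split; [|intros [W [[_ HW] Wx]]; auto].
    intro Ux; destruct (bicyclic_or_outside x) as [[c ->]|Hx].
    + exists (fun z => fst z = Some c /\ True); split; [split|rewrite cup_map_bicyclic; auto].
      * apply (open_box (alpha_top (nat * nat)) T (fun o => o = Some c) (fun _ => True));
          [intro h; discriminate | apply open_setT].
      * intros y [E _]; destruct (bicyclic_or_outside y) as [[d ->]|Hy].
        -- rewrite cup_map_bicyclic in E; injection E as ->; auto.
        -- rewrite cup_map_outside in E by auto; discriminate.
    + destruct (exceptional_finite x U reg cc Hx oU Ux) as [V [oV [Vx [HV [l Hl]]]]].
      (* The finitely many exceptional [c] are cut off by a neighbourhood of infinity in the first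
         coordinate. *)
      exists (fun z => (forall c, fst z = Some c -> ~ In c l) /\ V (snd z)).
      split; [split|rewrite cup_map_outside by auto; split; [discriminate | auto]].
      * apply (open_box (alpha_top (nat * nat)) T (fun o => forall c, o = Some c -> ~ In c l)); [|exact oV].
        intros _; exists l; intros d Hd c E; injection E as <-; auto.
      * intros y [h1 h2]; destruct (bicyclic_or_outside y) as [[d ->]|Hy].
        -- rewrite cup_map_bicyclic in h1, h2; apply NNPP; intro nU; apply (h1 d eq_refl), Hl; auto.
        -- rewrite cup_map_outside in h2 by auto; auto.
Qed.

(* Otherwise [(q^n, p^n)] would cluster at [(x, y)], while [q^n p^n = 1] and [x y] lies in the ideal [M]. *)
Lemma antidiagonal_locally_finite x y :
  regular T -> countably_compact_at T (fun x => exists c, x = j c) -> outside_C j x -> outside_C j y ->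
  exists U V, is_open T U /\ is_open T V /\ U x /\ V y /\
    exists N, forall n, N <= n -> ~ (U (apow 0 n) /\ V (apow n 0)).
Proof.
  intros reg cc Hx Hy.
  destruct (mul_nbhd x y (fun z => z <> j (0, 0))) as [U [V [oU [oV [Ux [Vy HUV]]]]]].
  - apply open_neq; auto.
  - apply mul_outside_l, Hx.
  - destruct (exceptional_finite x U reg cc Hx oU Ux) as [U' [oU' [Ux' [_ fU]]]].
    destruct (exceptional_finite y V reg cc Hy oV Vy) as [V' [oV' [Vy' [_ fV]]]].
    destruct (finite_set_bounded _ (fun n => (0, n)) ltac:(congruence) fU) as [N HN].
    destruct (finite_set_bounded _ (fun n => (n, 0)) ltac:(congruence) fV) as [N' HN'].
    exists U', V'; repeat split; auto; exists (N + N'); intros n Hn [h1 h2].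
    apply (HUV (j (0, n)) (j (n, 0))).
    + apply NNPP; intro h; apply (HN n); [lia | split; auto].
    + apply NNPP; intro h; apply (HN' n); [lia | split; auto].
    + bicyclic.
Qed.

Local Notation M := {x | outside_C j x}.
Local Notation TM := (subspace T (outside_C j)).

Lemma antidiagonal_closed_discrete :
  regular T -> countably_compact_at T (fun x => exists c, x = j c) ->
  let P := fun z : M * M => exists n, proj1_sig (fst z) = apow 0 n /\ proj1_sig (snd z) = apow n 0 in
  is_closed (prod_top TM TM) P /\ discrete_set (prod_top TM TM) P.
Proof.
  intros reg cc P.
  pose (aM := fun n m => exist (outside_C j) (apow n m) (apow_outside n m)).
  apply (locally_finite_closed_discrete (prod_top TM TM) (fun n => (aM 0 n, aM n 0))).
  - apply hausdorff_prod; apply hausdorff_subspace, Hhaus.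
  - intros [z w]; split; intros [n Hn]; exists n.
    + f_equal; apply sig_eq, Hn.
    + injection Hn as -> ->; auto.
  - intros [[x Hx] [y Hy]]; destruct (antidiagonal_locally_finite x y reg cc Hx Hy)
      as [U [V [oU [oV [Ux [Vy [N HN]]]]]]].
    exists (fun z : M * M => U (proj1_sig (fst z)) /\ V (proj1_sig (snd z))); split.
    + apply (open_box TM TM (fun z => U (proj1_sig z)) (fun z => V (proj1_sig z)));
        apply open_subspace; auto.
    + split; [auto|]; exists N; exact HN.
Qed.

(** * Failure of uniform continuity of multiplication and its consequences *)

(** Local finiteness at [(e, e)] prevents [a^-k] and [a^k] from both lying in [U] once [k >= N]; any
    infinite [I] has two members at distance at least [N]. *)
Lemma nonreturning_nbhd : regular T -> countably_compact_at T (fun x => exists c, x = j c) ->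
  exists U, is_open T U /\ U e /\
    forall I, unbounded I -> exists n m, I n /\ I m /\ ~ U (apow n m).
Proof.
  intros reg cc; destruct (antidiagonal_locally_finite e e reg cc e_outside e_outside)
    as [U [V [oU [oV [Ue [Ve [N HN]]]]]]].
  exists (fun x => U x /\ V x); split; [apply open_inter; auto|]; split; [auto|].
  intros I uI; apply NNPP; intro h.
  destruct (uI 0) as [m [_ Im]]; destruct (uI (m + N)) as [n [Hn In]].
  apply (HN (n - m)); [lia|]; split.
  - rewrite (apow_eq 0 (n - m) m n) by lia; apply NNPP; intro; apply h; exists m, n; tauto.
  - rewrite (apow_eq (n - m) 0 n m) by lia; apply NNPP; intro; apply h; exists n, m; tauto.
Qed.

(** Either [c] repeats one value infinitely often, or its range is infinite and accumulates at a
    point of [M], which the projection by [e] fixes. *)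
Lemma apow_clustering (c : nat -> nat * nat) : countably_compact_at T (fun x => exists c, x = j c) ->
  exists x, outside_C j x /\ forall U, is_open T U -> U x -> unbounded (fun n => U (mul (j (c n)) e)).
Proof.
  intro cc; destruct (classic (exists d, unbounded (fun n => c n = d))) as [[d ud]|h].
  - exists (mul (j d) e); split; [apply mul_e_outside|].
    intros U oU Ud N; destruct (ud N) as [n [hn <-]]; eauto.
  - destruct (cc (fun x => exists n, x = j (c n))) as [x Hx].
    + intros x [n ->]; eauto.
    + intros [l Hl]; apply h.
      destruct (unbounded_pigeonhole l (fun x n => x = j (c n)) (fun _ => True)) as [x [_ ux]].
      * intro N; exists N; auto.
      * intros n _; eauto.
      * destruct (ux 0) as [k [_ [_ ->]]]; exists (c k); intro N.
        destruct (ux N) as [n [hn [_ E]]]; exists n; split; [auto | symmetry; apply Hjinj, E].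
    + assert (Hx' : outside_C j x) by exact (accumulation_outside _ _ Hx).
      exists x; split; [exact Hx'|]; intros U oU Ux N; rewrite <- (mul_e_id x Hx') in Ux.
      destruct (accumulation_unbounded T _ (fun n => j (c n)) x _ Hx (fun y H => H)
        (continuous_mulr e U oU) Ux N) as [n [hn [Un _]]]; eauto.
Qed.

(** [x] is a cluster point of the powers [a^n], and [f] is 0 at [e] and 1 off [U]. Near [x] there
    are [a^n], [a^m] with [a^(n-m)] outside [U]; for [y = a^-m] the values at [a^n y] and [a^m y]
    are 1 and 0, so they cannot both be within [1/4] of [f (x y)]. *)
Lemma exists_nonuniform : tychonoff T -> countably_compact_at T (fun x => exists c, x = j c) ->
  exists f : S -> R, continuous T R_top f /\ (forall x, (0 <= f x <= 1)%R) /\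
    exists x : M, forall A, is_open TM A -> A x ->
      exists x' y : M, A x' /\
        (1 / 4 < Rabs (f (mul (proj1_sig x') (proj1_sig y)) - f (mul (proj1_sig x) (proj1_sig y))))%R.
Proof.
  intros tych cc.
  destruct (nonreturning_nbhd (tychonoff_regular T tych) cc) as [U [oU [Ue HU]]].
  destruct (tychonoff_separation T e U tych oU Ue) as [f [cf [f01 [fe fU]]]].
  exists f; split; [auto|]; split; [auto|].
  destruct (apow_clustering (fun n => (n, 0)) cc) as [x [Hx Hcl]].
  exists (exist _ x Hx); intros A oA Ax; simpl.
  destruct (oA _ Ax) as [V [oV [Vx HV]]].
  destruct (HU _ (Hcl V oV Vx)) as [n [m [Vn [Vm nU]]]].
  pose (aM := fun n m => exist (outside_C j) (apow n m) (apow_outside n m)).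
  apply NNPP; intro h.
  assert (H : forall k, V (apow k 0) -> (Rabs (f (apow k m) - f (mul x (apow 0 m))) <= 1 / 4)%R).
  { intros k Vk; apply Rnot_lt_le; intro hk; apply h.
    exists (aM k 0), (aM 0 m); split; [apply HV, Vk|]; simpl.
    rewrite apow_mul, Nat.add_0_r; exact hk. }
  pose proof (H n Vn) as h1; pose proof (H m Vm) as h2; revert h1 h2.
  rewrite apow_diag, fe, (fU _ nU); unfold Rabs; repeat destruct Rcase_abs; lra.
Qed.

Lemma real_mul_nbhd (f : S -> R) x y eps : continuous T R_top f -> (0 < eps)%R ->
  exists A B, is_open T A /\ is_open T B /\ A x /\ B y /\
    forall x' y', A x' -> B y' -> (Rabs (f (mul x' y') - f (mul x y)) < eps)%R.
Proof.
  intros cf He; apply (mul_nbhd x y (fun z => (Rabs (f z - f (mul x y)) < eps)%R)).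
  - apply open_ball; auto.
  - replace (f (mul x y) - f (mul x y))%R with 0%R by ring; rewrite Rabs_R0; auto.
Qed.

Lemma square_not_pseudocompact :
  tychonoff T -> countably_compact_at T (fun x => exists c, x = j c) ->
  ~ pseudocompact (prod_top TM TM).
Proof.
  intros tych cc pc; destruct (exists_nonuniform tych cc) as [f [cf [_ [x0 Hx0]]]].
  destruct (box_clustering_uniform TM TM (fun x y => f (mul (proj1_sig x) (proj1_sig y)))
    (pseudocompact_box_clustering TM TM pc)) with (x0 := x0) (eps := (1 / 4)%R) as [A [oA [Ax H]]].
  - intros x y eps He; destruct (real_mul_nbhd f (proj1_sig x) (proj1_sig y) eps cf He)
      as [A [B [oA [oB [Ax [By H]]]]]].
    exists (fun z => A (proj1_sig z)), (fun z => B (proj1_sig z)).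
    repeat split; auto using open_subspace.
  - lra.
  - destruct (Hx0 A oA Ax) as [x' [y [Ax' h]]]; specialize (H x' y Ax'); lra.
Qed.

Lemma apow_meets_open (O : M -> Prop) z : is_open TM O -> O z ->
  exists c, O (exist _ (mul (j c) e) (mul_e_outside (j c))).
Proof.
  intros oO Oz; destruct (oO z Oz) as [V [oV [Vz HV]]].
  destruct (apow_dense _ (proj2_sig z) V oV Vz) as [y [Vy [n [m ->]]]].
  exists (n, m); apply HV, Vy.
Qed.

(** Powers of [a] are picked in the boxes. The second coordinates cluster, and metrizability of [K]
    yields indices along which their images converge; the first coordinates then cluster along these
    indices. *)
Lemma product_metrizable_box_clustering {K : Type} (TK : topology K) (p : M -> K) :
  countably_compact_at T (fun x => exists c, x = j c) ->
  metrizable TK -> continuous TM TK p -> (forall k, exists x, p x = k) ->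
  box_clustering TM TK.
Proof.
  intros cc [d [[dpos [d0 [dsym dtri]]] Hd]] cp sp O V HO HV.
  pose (aM := fun c => exist (outside_C j) (mul (j c) e) (mul_e_outside (j c))).
  destruct (choice (fun n c => O n (aM c))) as [c Hc].
  { intro n; destruct (HO n) as [oO [z Oz]]; exact (apow_meets_open _ z oO Oz). }
  destruct (choice (fun n c => V n (p (aM c)))) as [c' Hc'].
  { intro n; destruct (HV n) as [oV [k Vk]]; destruct (sp k) as [z <-].
    exact (apow_meets_open _ z (cp _ oV) Vk). }
  destruct (apow_clustering c' cc) as [y [Hy Hcl]].
  pose (y' := p (exist _ y Hy)).
  (* The indices [s k] need not increase: [k <= s k] makes them arbitrarily large. *)
  destruct (choice (fun k n => k <= n /\ (d y' (p (aM (c' n))) < / (INR k + 1))%R)) as [s Hs].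
  { intro k.
    assert (ob : is_open TK (fun z => (d y' z < / (INR k + 1))%R)).
    { apply Hd; intros z Hz; exists (/ (INR k + 1) - d y' z)%R; split; [lra|].
      intros w Hw; pose proof (dtri y' z w); lra. }
    destruct (cp _ ob (exist _ y Hy)) as [W [oW [Wy HW]]].
    - fold y'; rewrite (proj2 (d0 y' y') eq_refl).
      apply Rinv_0_lt_compat; pose proof (pos_INR k); lra.
    - destruct (Hcl W oW Wy k) as [n [hn Wn]]; exists n; split; [auto | apply (HW (aM (c' n))), Wn]. }
  destruct (apow_clustering (fun k => c (s k)) cc) as [x [Hx Hcl']].
  exists (exist _ x Hx), y'; intros A B oA Ax oB By N.
  destruct (oA _ Ax) as [W [oW [Wx HW]]].
  destruct (proj1 (Hd B) oB y' By) as [eps [He HB]].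
  destruct (archimed_cor1 eps He) as [N' [HN' HN0]].
  destruct (Hcl' W oW Wx (N + N')) as [k [hk Wk]].
  destruct (Hs k) as [hsk hd].
  exists (s k); split; [lia|]; split.
  - exists (aM (c (s k))); split; [apply HW, Wk | apply Hc].
  - exists (p (aM (c' (s k)))); split; [|apply Hc'].
    apply HB; apply Rlt_trans with (1 := hd); apply Rlt_trans with (2 := HN').
    apply lt_INR in HN0; simpl in HN0; assert (INR N' <= INR k)%R by (apply le_INR; lia).
    apply Rinv_lt_contravar; [apply Rmult_lt_0_compat|]; lra.
Qed.

(* The maps [y |-> f (a^k y)] jointly factor through an open map [p : M -> K] onto a metrizable
   space, hence so does [f (x y)] in its second argument, for every [x]. *)
Lemma not_openly_factorizable :
  tychonoff T -> countably_compact_at T (fun x => exists c, x = j c) -> ~ openly_factorizable TM.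
Proof.
  intros tych cc fact; destruct (exists_nonuniform tych cc) as [f [cf [f01 [x0 Hx0]]]].
  assert (cfl : forall x, continuous T R_top (fun y => f (mul x y))).
  { intros x V oV; exact (continuous_mull x _ (cf V oV)). }
  assert (cfr : forall y, continuous T R_top (fun x => f (mul x y))).
  { intros y V oV; exact (continuous_mulr y _ (cf V oV)). }
  (* Cantor pairing turns the dense group of powers of [a] into a sequence. *)
  pose (s := fun n => mul (j (Cantor.of_nat n)) e).
  assert (Es : forall c, mul (j c) e = s (Cantor.to_nat c)).
  { intro c; unfold s; rewrite Cantor.cancel_of_to; auto. }
  destruct (countable_family_sep_metrizable TM (fun n => exist _ (s n) (mul_e_outside _))
    (fun n y => f (mul (s n) (proj1_sig y)))) as [Y [TY [G [sY [cG HG]]]]].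
  { intros z O oO Oz; destruct (apow_meets_open O z oO Oz) as [c Hc].
    exists (exist _ (mul (j c) e) (mul_e_outside (j c))); split; [exact Hc|].
    exists (Cantor.to_nat c); apply sig_eq, Es. }
  { intros n V oV; exact (open_subspace T (outside_C j) _ (cfl (s n) V oV)). }
  { intros n y; apply f01. }
  destruct (fact Y TY sY G cG) as [K [TK [p [h [[_ mK] [cp [op [sp [_ Hh]]]]]]]]].
  (* The factorization gives this for [x] a power of [a]; density extends it to all [x]. *)
  assert (Hp : forall x y y' : M, p y = p y' ->
    f (mul (proj1_sig x) (proj1_sig y)) = f (mul (proj1_sig x) (proj1_sig y'))).
  { intros [x Hx] y y' E; simpl.
    apply (eq_on_closure T R_top (fun x => f (mul x (proj1_sig y))) (fun x => f (mul x (proj1_sig y')))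
      _ x hausdorff_R (cfr _) (cfr _)) with (2 := apow_dense x Hx).
    intros z [n [m ->]]; unfold apow; rewrite Es; apply HG; rewrite !Hh, E; auto. }
  (* A merely set-theoretic section of [p]: by [Hp] the value [f (x (r k))] does not depend on the
     chosen preimage. *)
  destruct (choice (fun k x => p x = k) sp) as [r Hr].
  destruct (box_clustering_uniform TM TK (fun x k => f (mul (proj1_sig x) (proj1_sig (r k))))
    (product_metrizable_box_clustering TK p cc mK cp sp)) with (x0 := x0) (eps := (1 / 4)%R)
    as [A [oA [Ax H]]].
  - intros x k eps He; destruct (real_mul_nbhd f (proj1_sig x) (proj1_sig (r k)) eps cf He)
      as [A [B [oA [oB [Ax [Bk H]]]]]].
    (* Openness of [p] is used here: the image of [B] is a neighbourhood of [k], so the induced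
       function on the product of [M] and [K] is continuous. *)
    exists (fun z => A (proj1_sig z)), (fun l => exists y : M, B (proj1_sig y) /\ p y = l).
    split; [apply open_subspace, oA|]; split; [apply op, open_subspace, oB|].
    split; [exact Ax|]; split; [eauto|].
    intros x' l Ax' [y [By <-]]; rewrite (Hp x' _ y) by apply Hr; auto.
  - lra.
  - destruct (Hx0 A oA Ax) as [x' [y [Ax' h']]]; specialize (H x' (p y) Ax').
    rewrite (Hp x' _ y), (Hp x0 _ y) in H by apply Hr; lra.
Qed.

(** * Dense totally bounded subgroups *)

Lemma no_dense_totally_bounded_subgroup (H : S -> Prop) (u : S) (inv : S -> S) :
  regular T -> countably_compact_at T (fun x => exists c, x = j c) ->
  (forall h, H h -> outside_C j h) -> H u ->
  (forall h, H h -> mul u h = h /\ mul h u = h) ->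
  (forall h, H h -> H (inv h) /\ mul h (inv h) = u /\ mul (inv h) h = u) ->
  (forall h U, H h -> is_open T U -> U (inv h) ->
     exists V, is_open T V /\ V h /\ forall g, H g -> V g -> U (inv g)) ->
  (forall x U, outside_C j x -> is_open T U -> U x -> exists h, H h /\ U h) ->
  ~ (forall U, is_open T U -> U u ->
       exists l : list S, (forall g, In g l -> H g) /\
         forall h, H h -> exists g w, In g l /\ H w /\ U w /\ h = mul g w).
Proof.
  intros reg cc HM Hu Hunit Hinv Hcinv Hdense Htb.
  (* [u x = x] passes from the dense [H] to [x = e], while [u e = u] because [u] is in [M]. *)
  assert (E : u = e).
  { transitivity (mul u e); [symmetry; apply mul_e_id, HM, Hu|].
    apply (eq_on_closure T T (fun x => mul u x) (fun x => x) H e Hhaus (continuous_mull u) continuous_id).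
    - intros h Hh; apply Hunit, Hh.
    - intros U oU Ue; destruct (Hdense e U e_outside oU Ue) as [h [Hh Uh]]; eauto. }
  subst u.
  assert (Einv : inv e = e).
  { destruct (Hinv e Hu) as [h1 [h2 _]]; rewrite (e_mul_id _ (HM _ h1)) in h2; exact h2. }
  destruct (nonreturning_nbhd reg cc) as [U [oU [Ue HU]]].
  (* The chain of neighbourhoods of [e]: [U1 U2] lies in [U], the closure of [P] in both [U1] and
     [U2], [P1 P2] in [P], and inversion takes the points of [H] in [W] into [P2]. *)
  destruct (mul_nbhd e e U oU) as [U1 [U2 [oU1 [oU2 [U1e [U2e HU12]]]]]]; [rewrite e_idem; auto|].
  destruct (regular_shrink T (fun x => U1 x /\ U2 x) e reg) as [P [oP [Pe HP]]];
    [apply open_inter; auto | auto |].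
  destruct (mul_nbhd e e P oP) as [P1 [P2 [oP1 [oP2 [P1e [P2e HP12]]]]]]; [rewrite e_idem; auto|].
  destruct (Hcinv e P2 Hu oP2) as [W [oW [We HW]]]; [rewrite Einv; auto|].
  pose (V := fun x => W x /\ P x); pose (VH := fun x => V x /\ H x).
  assert (oV : is_open T V) by (apply open_inter; auto).
  assert (clVP : forall x, closure T VH x -> closure T P x).
  { intro x; apply closure_mono; intros y [[_ h] _]; exact h. }
  (* Inversion is continuous at [e] on all units of [M]: if [x] and [x'] are approximated by
     [k] and [h] in [H], then [h = (h k) k^-1] with [h k] close to [x' x = e]. *)
  assert (Hback : forall x x', outside_C j x' -> mul x' x = e -> closure T VH x -> closure T P x').
  { intros x x' Hx' Exx Hx O oO Ox'.
    destruct (mul_nbhd x' x P1 oP1) as [A [B [oA [oB [Ax' [Bx HAB]]]]]]; [rewrite Exx; auto|].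
    destruct (Hx B oB Bx) as [k [Bk [[Wk _] Hk]]].
    destruct (Hdense x' (fun y => A y /\ O y) Hx') as [h [Hh [Ah Oh]]]; [apply open_inter; auto | auto |].
    exists h; split; [exact Oh|].
    destruct (Hinv k Hk) as [_ [Ek _]].
    replace h with (mul (mul h k) (inv k)); [auto|].
    rewrite <- Hassoc, Ek; apply Hunit, Hh. }
  destruct (Htb V oV (conj We Pe)) as [l [Hl Hcov]].
  destruct (unbounded_pigeonhole l (fun t n => closure T VH (mul (inv t) (apow n 0))) (fun _ => True))
    as [t [Ht ut]].
  - intro N; exists N; auto.
  (* The conditions on [y = a^n] that negate membership in each translate are open, so a failure
     would be shared by some [h] in [H], which the finite cover excludes. *)
  - intros n _; apply NNPP; intro hn.
    destruct (Hdense (apow n 0) (fun y => forall t, In t l -> ~ closure T VH (mul (inv t) y)))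
      as [h [Hh Oh]].
    + apply apow_outside.
    + apply open_forall_in; intros t _.
      exact (continuous_mull (inv t) _ (open_not_closure T VH)).
    + intros t Ht h; apply hn; eauto.
    + destruct (Hcov h Hh) as [t [w [Ht [Hw [Vw ->]]]]]; apply (Oh t Ht).
      destruct (Hinv t (Hl t Ht)) as [_ [_ Et]]; rewrite Hassoc, Et.
      rewrite (proj1 (Hunit w Hw)); intros O oO Ow; exists w; split; [auto | split; auto].
  - destruct (HU _ ut) as [n [m [[_ Hn] [[_ Hm] nU]]]]; apply nU.
    destruct (Hinv t (Hl t Ht)) as [_ [Et _]].
    (* For [k = n] this splits [a^(n-m)] into two factors; for [k = m] it shows that the first
       factor is inverse to [t^-1 a^m], so that [Hback] applies. *)
    assert (Ekey : forall k, mul (mul (apow 0 m) t) (mul (inv t) (apow k 0)) = apow k m).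
    { intro k; rewrite <- Hassoc, (Hassoc t), Et, (e_mul_id _ (apow_outside k 0)), apow_mul; auto. }
    rewrite <- (Ekey n); apply HU12.
    + apply (HP (mul (apow 0 m) t)).
      apply (Hback (mul (inv t) (apow m 0))); [|rewrite Ekey; apply apow_diag | exact Hm].
      apply mul_outside_l, apow_outside.
    + apply HP, clVP, Hn.
Qed.

End Bicyclic.

Theorem theorem5p2
  (S : Type) (T : topology S) (mul : S -> S -> S) (j : nat * nat -> S)
  (* S is a Hausdorff topological semigroup *)
  (Hassoc : forall x y z, mul x (mul y z) = mul (mul x y) z)
  (Hcont : continuous (prod_top T T) T (fun z => mul (fst z) (snd z)))
  (Hhaus : hausdorff T)
  (* j embeds the bicyclic semigroup C(p,q) (p^m q^n = (m,n)) as a dense subsemigroup *)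
  (Hjinj : forall c d, j c = j d -> c = d)
  (Hjhom : forall c d, j (bic c d) = mul (j c) (j d))
  (Hjdense : dense T (fun x => exists c, x = j c))
  (* S is countably compact at E_C = {p^n q^n} *)
  (Hcc : countably_compact_at T (fun x => exists n, x = j (n, n))) :
  exists e : S,
  (* (1) *)
  (compact_set T (closure T (fun x => exists n, x = j (n, n))) /\
   nonisolated_in T (closure T (fun x => exists n, x = j (n, n))) e /\
   (forall x, nonisolated_in T (closure T (fun x => exists n, x = j (n, n))) x -> x = e) /\
   mul e e = e /\ (forall x, mul x e = mul e x) /\
   converges T (fun n => j (n, n)) e) /\
  (* (2)  pi(x) = x e *)
  (continuous T T (fun x => mul x e) /\
   (forall x y, mul (mul x y) e = mul (mul x e) (mul y e)) /\
   (forall x, outside_C j (mul x e)) /\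
   (forall m, outside_C j m -> mul m e = m) /\
   (forall x y, outside_C j y -> outside_C j (mul x y) /\ outside_C j (mul y x)) /\
   outside_C j e /\ (forall m, outside_C j m -> mul e m = m /\ mul m e = m)) /\
  (* (3),(4),(5): a = pi(p) has an inverse b in M, Z = {a^k : k in Z} is dense in M *)
  (exists b : S,
     let a := mul (j (1, 0)) e in
     outside_C j b /\ mul a b = e /\ mul b a = e /\
     (forall x, outside_C j x -> closure T (fun y => exists k : Z, y = zpow mul e a b k) x) /\
     (forall n m, mul (j (n, m)) e = zpow mul e a b (Z.of_nat n - Z.of_nat m)) /\
     (forall k : nat,
        converges T (fun n => j (n + k, n)%nat) (zpow mul e a b (Z.of_nat k)) /\
        converges T (fun n => j (n, n + k)%nat) (zpow mul e a b (- Z.of_nat k)))) /\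
  (* (6) *)
  (regular T <-> regular (subspace T (outside_C j))) /\
  (* (7) *)
  (regular T -> countably_compact_at T (fun x => exists c, x = j c) ->
     (exists phi : S -> option (nat * nat) * S,
        (forall c, phi (j c) = (Some c, mul (j c) e)) /\
        (forall m, outside_C j m -> phi m = (None, m)) /\
        (forall x, cup_points j (fun y => mul y e) (phi x)) /\
        (forall z, cup_points j (fun y => mul y e) z -> exists x, phi x = z) /\
        (forall x y, phi (mul x y) = cup_mul mul j (fun y => mul y e) (phi x) (phi y)) /\
        embedding T (prod_top (alpha_top (nat * nat)) T) phi) /\
     (let TM := subspace T (outside_C j) in
      let P := fun z : {x | outside_C j x} * {x | outside_C j x} =>
        exists n, proj1_sig (fst z) = mul (j (0, n)%nat) e /\
                  proj1_sig (snd z) = mul (j (n, 0)%nat) e in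
      is_closed (prod_top TM TM) P /\ discrete_set (prod_top TM TM) P)) /\
  (* (8) *)
  (tychonoff T -> countably_compact_at T (fun x => exists c, x = j c) ->
     ~ openly_factorizable (subspace T (outside_C j)) /\
     ~ pseudocompact (prod_top (subspace T (outside_C j)) (subspace T (outside_C j))) /\
     ~ (exists (H : S -> Prop) (u : S) (inv : S -> S),
          (* H is a subgroup of M with identity u and inversion inv *)
          (forall h, H h -> outside_C j h) /\ H u /\
          (forall h, H h -> mul u h = h /\ mul h u = h) /\
          (forall h g, H h -> H g -> H (mul h g)) /\
          (forall h, H h -> H (inv h) /\ mul h (inv h) = u /\ mul (inv h) h = u) /\
          (* H is a topological group in the subspace topology *)
          (forall h g U, H h -> H g -> is_open T U -> U (mul h g) ->
             exists V W, is_open T V /\ is_open T W /\ V h /\ W g /\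
               forall h' g', H h' -> H g' -> V h' -> W g' -> U (mul h' g')) /\
          (forall h U, H h -> is_open T U -> U (inv h) ->
             exists V, is_open T V /\ V h /\ forall g, H g -> V g -> U (inv g)) /\
          (* H is dense in M *)
          (forall x U, outside_C j x -> is_open T U -> U x -> exists h, H h /\ U h) /\
          (* H is totally bounded *)
          (forall U, is_open T U -> U u ->
             exists l : list S, (forall g, In g l -> H g) /\
               forall h, H h -> exists g w, In g l /\ H w /\ U w /\ h = mul g w))).
Proof.
  destruct (EC_converges T mul j Hcont Hhaus Hjinj Hjhom Hcc) as [e [Hacc Hlim]].
  assert (Habs : forall n, mul (j (n, n)) e = e) by (intro n; eapply accumulation_absorbs; eauto).
  exists e.
  split; [|split; [|split; [|split; [|split]]]].
  - repeat split.
    + eapply compact_closure_EC; eauto.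
    + eapply nonisolated_closure_EC; eauto.
    + eapply nonisolated_closure_EC; eauto.
    + intro x; eapply nonisolated_closure_EC_unique; eauto.
    + eapply e_idem; eauto.
    + intro x; eapply e_central; eauto.
    + exact Hlim.
  - assert (Ho : outside_C j e) by (eapply e_outside; eauto).
    assert (Hr : forall m, outside_C j m -> mul m e = m) by (intros m; eapply mul_e_id; eauto).
    split; [eapply continuous_mulr; eauto|].
    split; [intros x y; eapply mul_e_mul; eauto|].
    split; [intros x; eapply mul_e_outside; eauto|].
    split; [exact Hr|].
    split; [|split; [exact Ho|]].
    + intros x y Hy; split; [eapply mul_outside_r | eapply mul_outside_l]; eauto.
    + intros m Hm; split; [eapply e_mul_id; eauto | auto].
  (* The inverse of [a = p e] is [q e]. *)
  - exists (mul (j (0, 1)) e); intro a.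
    assert (Hz : forall z n m, z = (Z.of_nat n - Z.of_nat m)%Z ->
      zpow mul e a (mul (j (0, 1)) e) z = mul (j (n, m)) e) by (intros z n m; eapply zpow_apow; eauto).
    assert (Hmul : forall n m i k,
      mul (mul (j (n, m)) e) (mul (j (i, k)) e) = mul (j (n + i, m + k)) e)
      by (intros n m i k; eapply apow_mul; eauto).
    split; [eapply mul_e_outside; eauto|].
    split; [unfold a; rewrite Hmul; apply Habs|].
    split; [unfold a; rewrite Hmul; apply Habs|].
    split; [|split].
    + intros x Hx; apply closure_mono with (fun y => exists n m, y = mul (j (n, m)) e).
      * intros y [n [m ->]]; exists (Z.of_nat n - Z.of_nat m)%Z; symmetry; apply Hz; auto.
      * eapply apow_dense; eauto.
    + intros n m; symmetry; apply Hz; auto.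
    + assert (Hconv : forall n m, converges T (fun i => j (n + i, m + i)) (mul (j (n, m)) e))
        by (intros n m; eapply j_converges; eauto).
      intro k; rewrite (Hz (Z.of_nat k) k 0), (Hz (- Z.of_nat k)%Z 0 k) by lia; split.
      * replace (fun n => j (n + k, n)) with (fun n => j (k + n, 0 + n)); [apply Hconv|].
        apply functional_extensionality; intro n; do 2 f_equal; lia.
      * replace (fun n => j (n, n + k)) with (fun n => j (0 + n, k + n)); [apply Hconv|].
        apply functional_extensionality; intro n; do 2 f_equal; lia.
  - split; [apply regular_subspace | eapply regular_from_outside; eauto].
  - intros reg cc; split.
    + exists (cup_map mul j e).
      assert (Hin : forall c, cup_map mul j e (j c) = (Some c, mul (j c) e))
        by (intro c; eapply cup_map_bicyclic; eauto).
      assert (Hout : forall m, outside_C j m -> cup_map mul j e m = (None, m))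
        by (intros m; eapply cup_map_outside; eauto).
      split; [exact Hin|]; split; [exact Hout|]; split; [|split; [|split]].
      * intro x; destruct (bicyclic_or_outside j x) as [[c ->]|Hx].
        -- left; exists c; apply Hin.
        -- right; exists x; auto.
      * intros z [[c ->]|[m [Hm ->]]]; eauto.
      * intros x y; eapply cup_map_mul; eauto.
      * eapply cup_map_embedding; eauto.
    + eapply antidiagonal_closed_discrete; eauto.
  - intros tych cc; split; [|split].
    + eapply not_openly_factorizable; eauto.
    + eapply square_not_pseudocompact; eauto.
    + pose proof (tychonoff_regular T tych) as reg.
      intros [H [u [inv [h1 [h2 [h3 [h4 [h5 [_ [h7 [h8 h9]]]]]]]]]]].
      revert h9; eapply no_dense_totally_bounded_subgroup; eauto.
Qed.
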